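(* Let $\varphi(i,Y)$ be a $\Sigma^B_0$ formula. The following is provable in $V^1$: if $\varphi$ is inflationary, i.e. $(\forall Y\le x)(\forall i<x)[Y(i)\to\varphi(i,Y)]$, then there exists a string $U$ with $U\le\mathrm{One}(|x|)$ such that $$\forall Y,Z\,[\psi_{P_\varphi}(x,2x,S(U),Y)\wedge\psi_{P_\varphi}(x,2x,U,Z)\to(\forall i<x)(Y(i)\leftrightarrow Z(i))].$$
   Context: Two-sorted Cook–Nguyen bounded arithmetic over the vocabulary $\mathcal L^2_A$ (numbers; strings = finite subsets of $\mathbb N$; $|X|$ = string length, one plus the largest element; $X(t)$ means $t\in X$; a string $X$ is identified with the binary number $\sum_{i\in X}2^i$; $(\exists X\le t)$ means $\exists X(|X|\le t\wedge\cdot)$). $\Sigma^B_0$ formulas have only bounded number quantifiers; $\Sigma^B_1$ formulas are $(\exists\vec X\le\vec t)\varphi$ with $\varphi\in\Sigma^B_0$. $V^1$ is the theory with basic axioms B1–B12, L1, L2, SE and $\Sigma^B_1$-comprehension $\forall x(\exists Y\le x)(\forall i<x)[Y(i)\leftrightarrow\varphi(i)]$, with $\Sigma^B_0$-defined functions available: $\emptyset$; string successor $S(X)$ (binary $X+1$); string ordering $X\le Y$ (comparison of binary values); $\mathrm{One}(y)$, the string with $\mathrm{One}(y)(i)\leftrightarrow i<y$; the pairing $\langle x,y\rangle=(x+y)(x+y+1)+2y$; the row $Z^{[x]}(i)\leftrightarrow i<|Z|\wedge Z(\langle x,i\rangle)$; and the sequence element $(Z)^x$ = least $y<|Z|$ with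 $Z(\langle x,y\rangle)$, or $|Z|$ if none. For a number $x$, $|x|$ denotes its binary length (so $|2x|=|x|+1$). The function $\mathrm{val}(x,X)$ (the numerical value of the last, i.e. most significant, $x$ bits of $X$) is given by $\mathrm{val}(x,\emptyset)=0$, $\mathrm{val}(0,X)=0$, and $\mathrm{val}(x+1,X)$ equals $\mathrm{val}(x,X)$ if $|X|\le x$, $2\,\mathrm{val}(x,X)$ if $x<|X|$ and $\neg X(|X|-1-x)$, and $2\,\mathrm{val}(x,X)+1$ if $x<|X|$ and $X(|X|-1-x)$; in $V^1$, for $x\le|y|$, the relation $\mathrm{val}(x,X)=z$ is expressed by the formula asserting the existence of a string $W$ with $|W|\le\langle x,2y+1\rangle+1$ such that $z=0$ if $|X|=0$ and otherwise $(W)^0=0$, $(W)^x=z$ and for all $j<x$: $(W)^{j+1}=(W)^j$ if $|X|\le j$, $(W)^{j+1}=2(W)^j$ if $j<|X|\wedge\neg X(|X|-1-j)$, $(W)^{j+1}=2(W)^j+1$ if $j<|X|\wedge X(|X|-1-j)$. $\psi_{P_\varphi}(x,y,X,Y)$ denotes the formula asserting: there is a string $Z$ with $|Z|\le\langle v,x\rangle+1$, where $v=\mathrm{val}(|y|,X)$, such that $|Z^{[j]}|\le x$ for all $j\le v$, $Z^{[0]}=\emptyset$, $Z^{[v]}=Y$, and $(\forall j<v)(\forall i<x)[Z^{[j+1]}(i)\leftrightarrow\varphi(i,Z^{[j]})]$. It expresses that $Y$ is the result of iterating $v$ times the operator $W\mapsto\{i<x:\varphi(i,W)\}$ starting from $\emptyset$.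 *)

(* Defs.v *)
From Stdlib Require List.
From mathcomp Require Export all_boot.

Set Implicit Arguments.
Unset Strict Implicit.
Unset Printing Implicit Defensive.

(* Both sorts of variables are de Bruijn indices, counted separately: a number
   quantifier binds number variable 0 and a string quantifier binds string
   variable 0.  L^2_A has no string functions, so the only string terms are
   string variables. *)
Notation svar := nat (only parsing).

Inductive nterm : Type :=
| NVar of nat
| NZero
| NOne
| NAdd of nterm & nterm
| NMul of nterm & nterm
| NLen of svar.

Inductive form : Type :=
| FBot
| FEqN of nterm & nterm
| FEqS of svar & svar
| FLe of nterm & nterm
| FMem of nterm & svar   (* FMem t X is X(t) *)
| FImp of form & form
| FAnd of form & form
| FOr of form & form
| FAllN of form
| FExN of form
| FAllS of form
| FExS of form.

Definition FNot (A : form) : form := FImp A FBot.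
Definition FIff (A B : form) : form := FAnd (FImp A B) (FImp B A).
Definition FLt (t u : nterm) : form := FAnd (FLe t u) (FNot (FEqN t u)).

Declare Scope form_scope.
Delimit Scope form_scope with F.
Bind Scope form_scope with form.

Declare Scope nterm_scope.
Delimit Scope nterm_scope with T.
Bind Scope nterm_scope with nterm.

Notation "0" := NZero : nterm_scope.
Notation "1" := NOne : nterm_scope.
Notation "2" := (NAdd NOne NOne) : nterm_scope.
Notation "t + u" := (NAdd t u) : nterm_scope.
Notation "t * u" := (NMul t u) : nterm_scope.

Notation "t == u" := (FEqN t%T u%T) : form_scope.
Notation "t <= u" := (FLe t%T u%T) : form_scope.
Notation "t < u" := (FLt t%T u%T) : form_scope.
Notation "~ A" := (FNot A) : form_scope.
Notation "A /\ B" := (FAnd A B) : form_scope.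
Notation "A \/ B" := (FOr A B) : form_scope.
Notation "A -> B" := (FImp A B) : form_scope.
Notation "A <-> B" := (FIff A B) : form_scope.

Fixpoint tsubst (s : nat -> nterm) (r : nat -> svar) (t : nterm) : nterm :=
  match t with
  | NVar n => s n
  | NZero => NZero
  | NOne => NOne
  | NAdd t u => NAdd (tsubst s r t) (tsubst s r u)
  | NMul t u => NMul (tsubst s r t) (tsubst s r u)
  | NLen X => NLen (r X)
  end.

Definition shiftN (t : nterm) : nterm := tsubst (fun n => NVar n.+1) id t.
Definition shiftS (t : nterm) : nterm := tsubst NVar S t.

Definition scons (T : Type) (a : T) (s : nat -> T) (n : nat) : T :=
  if n is m.+1 then s m else a.

Fixpoint fsubst (s : nat -> nterm) (r : nat -> svar) (A : form) : form :=
  match A with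
  | FBot => FBot
  | FEqN t u => FEqN (tsubst s r t) (tsubst s r u)
  | FEqS X Y => FEqS (r X) (r Y)
  | FLe t u => FLe (tsubst s r t) (tsubst s r u)
  | FMem t X => FMem (tsubst s r t) (r X)
  | FImp A B => FImp (fsubst s r A) (fsubst s r B)
  | FAnd A B => FAnd (fsubst s r A) (fsubst s r B)
  | FOr A B => FOr (fsubst s r A) (fsubst s r B)
  | FAllN A => FAllN (fsubst (scons (NVar 0) (fun n => shiftN (s n))) r A)
  | FExN A => FExN (fsubst (scons (NVar 0) (fun n => shiftN (s n))) r A)
  | FAllS A =>
      FAllS (fsubst (fun n => shiftS (s n)) (scons 0%N (fun n => (r n).+1)) A)
  | FExS A =>
      FExS (fsubst (fun n => shiftS (s n)) (scons 0%N (fun n => (r n).+1)) A)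
  end.

Definition fshiftN (A : form) : form := fsubst (fun n => NVar n.+1) id A.
Definition fshiftS (A : form) : form := fsubst NVar S A.
Definition instN (A : form) (t : nterm) : form := fsubst (scons t NVar) id A.
Definition instS (A : form) (X : svar) : form := fsubst NVar (scons X id) A.

(* Classical natural deduction with equality.  Only the hypotheses G are
   shifted when a quantifier is crossed, so the non-logical axioms in T stand
   for their universal closures. *)
Inductive prov (T : form -> Prop) : seq form -> form -> Prop :=
| P_ax G A : T A -> prov T G A
| P_hyp G A : List.In A G -> prov T G A
| P_raa G A : prov T (FNot A :: G) FBot -> prov T G A
| P_impI G A B : prov T (A :: G) B -> prov T G (FImp A B)
| P_impE G A B : prov T G (FImp A B) -> prov T G A -> prov T G B
| P_andI G A B : prov T G A -> prov T G B -> prov T G (FAnd A B)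
| P_andEl G A B : prov T G (FAnd A B) -> prov T G A
| P_andEr G A B : prov T G (FAnd A B) -> prov T G B
| P_orIl G A B : prov T G A -> prov T G (FOr A B)
| P_orIr G A B : prov T G B -> prov T G (FOr A B)
| P_orE G A B C : prov T G (FOr A B) ->
    prov T (A :: G) C -> prov T (B :: G) C -> prov T G C
| P_allNI G A : prov T (map fshiftN G) A -> prov T G (FAllN A)
| P_allNE G A t : prov T G (FAllN A) -> prov T G (instN A t)
| P_exNI G A t : prov T G (instN A t) -> prov T G (FExN A)
| P_exNE G A C : prov T G (FExN A) ->
    prov T (A :: map fshiftN G) (fshiftN C) -> prov T G C
| P_allSI G A : prov T (map fshiftS G) A -> prov T G (FAllS A)
| P_allSE G A X : prov T G (FAllS A) -> prov T G (instS A X)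
| P_exSI G A X : prov T G (instS A X) -> prov T G (FExS A)
| P_exSE G A C : prov T G (FExS A) ->
    prov T (A :: map fshiftS G) (fshiftS C) -> prov T G C
| P_eqN_refl G t : prov T G (FEqN t t)
| P_eqN_subst G A t u :
    prov T G (FEqN t u) -> prov T G (instN A t) -> prov T G (instN A u)
| P_eqS_refl G X : prov T G (FEqS X X)
| P_eqS_subst G A X Y :
    prov T G (FEqS X Y) -> prov T G (instS A X) -> prov T G (instS A Y).

(* The bound t lives outside the quantifier, so it cannot contain the bound
   variable.  The strict versions are built from the non-strict ones, hence
   are themselves bounded quantifiers in the sense of SigmaB0. *)
Definition FAllLe (t : nterm) (A : form) : form :=
  FAllN (NVar 0 <= shiftN t -> A)%F.
Definition FExLe (t : nterm) (A : form) : form :=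
  FExN (NVar 0 <= shiftN t /\ A)%F.
Definition FAllLt (t : nterm) (A : form) : form :=
  FAllLe t (NVar 0 < shiftN t -> A)%F.
Definition FExLt (t : nterm) (A : form) : form :=
  FExLe t (NVar 0 < shiftN t /\ A)%F.
Definition FAllSLe (t : nterm) (A : form) : form :=
  FAllS (NLen 0 <= shiftS t -> A)%F.
Definition FExSLe (t : nterm) (A : form) : form :=
  FExS (NLen 0 <= shiftS t /\ A)%F.

Inductive SigmaB0 : form -> Prop :=
| S0_bot : SigmaB0 FBot
| S0_eqN t u : SigmaB0 (FEqN t u)
| S0_eqS X Y : SigmaB0 (FEqS X Y)
| S0_le t u : SigmaB0 (FLe t u)
| S0_mem t X : SigmaB0 (FMem t X)
| S0_imp A B : SigmaB0 A -> SigmaB0 B -> SigmaB0 (FImp A B)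
| S0_and A B : SigmaB0 A -> SigmaB0 B -> SigmaB0 (FAnd A B)
| S0_or A B : SigmaB0 A -> SigmaB0 B -> SigmaB0 (FOr A B)
| S0_all t A : SigmaB0 A -> SigmaB0 (FAllLe t A)
| S0_ex t A : SigmaB0 A -> SigmaB0 (FExLe t A).

Inductive SigmaB1 : form -> Prop :=
| S1_base A : SigmaB0 A -> SigmaB1 A
| S1_ex t A : SigmaB1 A -> SigmaB1 (FExSLe t A).

Section TheoryV1.
#[local] Notation x := (NVar 0).
#[local] Notation y := (NVar 1).
#[local] Notation X := 0%N.
#[local] Notation Y := 1%N.

Inductive V1 : form -> Prop :=
| V1_B1 : V1 (~ (x + 1 == 0))%F
| V1_B2 : V1 (x + 1 == y + 1 -> x == y)%F
| V1_B3 : V1 (x + 0 == x)%F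
| V1_B4 : V1 (x + (y + 1) == (x + y) + 1)%F
| V1_B5 : V1 (x * 0 == 0)%F
| V1_B6 : V1 (x * (y + 1) == (x * y) + x)%F
| V1_B7 : V1 (x <= y /\ y <= x -> x == y)%F
| V1_B8 : V1 (x <= x + y)%F
| V1_B9 : V1 (0 <= x)%F
| V1_B10 : V1 (x <= y \/ y <= x)%F
| V1_B11 : V1 (x <= y <-> x < y + 1)%F
| V1_B12 : V1 (~ (x == 0) -> FExLe x (NVar 0 + 1 == NVar 1))%F
| V1_L1 : V1 (FMem y X -> y < NLen X)%F
| V1_L2 : V1 (y + 1 == NLen X -> FMem y X)%F
| V1_SE : V1 (NLen X == NLen Y /\
           FAllLt (NLen X) (FMem (NVar 0) X <-> FMem (NVar 0) Y) -> FEqS X Y)%F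
(* In A, number variable 0 is i and number variable 1 is the bound x; all other
   variables are parameters.  fshiftS keeps the new string out of A. *)
| V1_Comp A : SigmaB1 A ->
    V1 (FAllN (FExSLe (NVar 0) (FAllLt (NVar 0) (FMem (NVar 0) 0 <-> fshiftS A))))%F.

End TheoryV1.

Definition V1_proves (A : form) : Prop := prov V1 [::] A.

(* Under a binder, every outer term t is written shiftN t or shiftS t, and
   under a string binder every outer string variable X is written X.+1. *)

Definition npair (t u : nterm) : nterm :=
  ((t + u) * (t + u + 1) + 2 * u)%T.

Definition isEmpty (X : svar) : form := (NLen X == 0)%F.

(* Y = S(X) *)
Definition isSucc (X Y : svar) : form :=
  (NLen Y <= NLen X + 1 /\
   FAllLe (NLen X)
     (FMem (NVar 0) Y <->
        (FMem (NVar 0) X /\ FExLt (NVar 0) (~ FMem (NVar 0) X)) \/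
        (~ FMem (NVar 0) X /\ FAllLt (NVar 0) (FMem (NVar 0) X))))%F.

(* X <= Y as binary numbers: equal, or Y has a 1 and X a 0 at the most
   significant position where they differ *)
Definition strLe (X Y : svar) : form :=
  (FEqS X Y \/
   FExLt (NLen Y)
     (FMem (NVar 0) Y /\ ~ FMem (NVar 0) X /\
      FAllLt (NLen X + NLen Y)
        (NVar 1 < NVar 0 -> (FMem (NVar 0) X <-> FMem (NVar 0) Y))))%F.

(* Y = One(t) *)
Definition isOne (t : nterm) (Y : svar) : form :=
  (NLen Y <= t /\ FAllLt t (FMem (NVar 0) Y))%F.

(* Z^[t](u) *)
Definition rowMem (Z : svar) (t u : nterm) : form :=
  (u < NLen Z /\ FMem (npair t u) Z)%F.

(* Y = Z^[t] *)
Definition isRow (Z : svar) (t : nterm) (Y : svar) : form :=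
  (NLen Y <= NLen Z /\
   FAllLt (NLen Z) (FMem (NVar 0) Y <-> rowMem Z (shiftN t) (NVar 0)))%F.

(* (Z)^t = u *)
Definition isSeq (Z : svar) (t u : nterm) : form :=
  ((u < NLen Z /\ FMem (npair t u) Z /\
    FAllLt u (~ FMem (npair (shiftN t) (NVar 0)) Z)) \/
   (u == NLen Z /\
    FAllLt (NLen Z) (~ FMem (npair (shiftN t) (NVar 0)) Z)))%F.

(* |t| = u for a number t: u is least with t < 2^u, the powers of two being
   listed by a string W with (W)^j = 2^j for j <= u.  The size bound on W is
   the one used for val below. *)
Definition isBinLen (t u : nterm) : form :=
  let t1 := shiftS t in
  let u1 := shiftS u in
  let W : svar := 0%N in
  FExSLe (npair u (2 * t + 1) + 1)
    (isSeq W 0 1 /\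
     FAllLt u1 (FExN (isSeq W (NVar 1) (NVar 0) /\
                    isSeq W (NVar 1 + 1) (2 * NVar 0) /\
                    NVar 0 <= shiftN (shiftN t1))) /\
     FExN (isSeq W (shiftN u1) (NVar 0) /\ shiftN t1 < NVar 0))%F.

(* X(|X| - 1 - t), for t < |X| *)
Definition bitFromTop (X : svar) (t : nterm) : form :=
  FExLt (NLen X) (NVar 0 + 1 + shiftN t == NLen X /\ FMem (NVar 0) X)%F.

(* val(t,X) = z, with size parameter y *)
Definition isVal (t y : nterm) (X : svar) (z : nterm) : form :=
  let t1 := shiftS t in
  let z1 := shiftS z in
  let X1 := X.+1 in
  let W : svar := 0%N in
  FExSLe (npair t (2 * y + 1) + 1)
    ((NLen X1 == 0 -> z1 == 0) /\
     (~ (NLen X1 == 0) ->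
        isSeq W 0 0 /\ isSeq W t1 z1 /\
        FAllLt t1 (* number variable 0 is j; below, 1 is j and 0 is (W)^j *)
          (FExN (isSeq W (NVar 1) (NVar 0) /\
             (NLen X1 <= NVar 1 -> isSeq W (NVar 1 + 1) (NVar 0)) /\
             (NVar 1 < NLen X1 /\ ~ bitFromTop X1 (NVar 1) ->
                isSeq W (NVar 1 + 1) (2 * NVar 0)) /\
             (NVar 1 < NLen X1 /\ bitFromTop X1 (NVar 1) ->
                isSeq W (NVar 1 + 1) (2 * NVar 0 + 1))))))%F.

(* A formula phi(i,Y) is a form whose number variable 0 is i and whose string
   variable 0 is Y; its number variables k+1 and string variables k+1 are
   parameters, denoting variables k of the ambient context. *)

Definition appOp (phi : form) (t : nterm) (W : svar) : form :=
  fsubst (scons t NVar) (scons W id) phi.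

(* phi seen from under n more number binders and m more string binders *)
Definition weakOp (n m : nat) (phi : form) : form :=
  fsubst (scons (NVar 0) (fun k => NVar (k + n).+1))
         (scons 0%N (fun k => (k + m).+1)) phi.

Definition psiP (phi : form) (x y : nterm) (X Y : svar) : form :=
  (* l = |y| *)
  FExN (isBinLen (shiftN y) (NVar 0) /\
  (* v = val(|y|,X) *)
  FExN (isVal (NVar 1) (shiftN (shiftN y)) X (NVar 0) /\
  let v := NVar 0 in
  let x2 := shiftN (shiftN x) in
  FExSLe (npair v x2 + 1)
   (let Z : svar := 0%N in
    let x3 := shiftS x2 in
    FAllLe v (FExS (isRow Z.+1 (NVar 0) 0%N /\
                  NLen 0 <= shiftS (shiftN x3))) /\
    FExS (isRow Z.+1 0 0%N /\ isEmpty 0%N) /\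
    isRow Z v Y.+1 /\
    FAllLt v (FAllLt (shiftN x3) (* number variable 1 is j, 0 is i *)
      (rowMem Z (NVar 1 + 1) (NVar 0) <->
       FExS (isRow Z.+1 (NVar 1) 0%N /\
            appOp (weakOp 4 2 phi) (NVar 0) 0%N))))))%F.

Definition inflationary (phi : form) (x : nterm) : form :=
  FAllSLe x (FAllLt (shiftS x)
    (FMem (NVar 0) 0%N -> appOp (weakOp 1 1 phi) (NVar 0) 0%N))%F.

(* Main.v *)
(** The theorem is proved semantically: by Henkin completeness of the calculus
    it is enough to argue in an arbitrary two-sorted model of V1.

    In a model, the string U := One(|x|) works. Comparing the sequences that
    witness the values of U and S(U) with the sequence of powers of two gives
    val(U) = 2^|x| - 1 =: v >= x and val(S(U)) = v + 1. The two iterations agree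
    up to stage v. If stage v + 1 differed from stage v, then every stage
    j <= v would add a new element below x, because an inflationary iteration
    that stops growing is constant from then on. This is an injective relation
    from x + 1 into x, which the pigeonhole principle refutes; that principle,
    like the existence of |x|, is an induction on a SigmaB1 property. *)

From Stdlib Require Import Classical ClassicalEpsilon Ring.
From Stdlib Require Import FunctionalExtensionality PropExtensionality.
Require Import Defs.

Set Implicit Arguments.
Unset Strict Implicit.
Unset Printing Implicit Defensive.

(* MathComp opens a scope of the same name, which would shadow the connectives. *)
Local Close Scope form_scope.

(** * Substitution *)

(** The model may be nonstandard, so induction from outside on its numbers is meaningless: every
    induction must be carried by a string of the model, hence concern a property given by a
    [SigmaB1] formula or the negation of one. Powers of two, values and iterations are accordingly
    never treated as functions; they exist only through witness strings, most of them supplied by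
    the hypotheses [psiP], which are compared entry by entry. The size parameter 2x is what makes
    both values come out. For nonzero x, |2x| = |x| + 1 is exactly the length of S(U), so [val]
    reads all of it; on U, one bit shorter, the surplus step repeats the value already reached. For
    x = 0 the equation |2x| = |x| + 1 fails, but then no i < x is left to check. U needs a value of
    at least x, to leave room for x + 1 stages, and bits so regular that each recurrence for [val]
    is a plain doubling: of val + 1 along the ones of U, of val along the zeros of S(U). *)

Notation upN s := (scons (NVar 0) (fun n => shiftN (s n))).
Notation upS r := (scons 0 (fun n => (r n).+1)).

Fixpoint tbound (t : nterm) : nat :=
  match t with
  | NVar n => n.+1
  | NZero | NOne => 0
  | NAdd t u | NMul t u => maxn (tbound t) (tbound u)
  | NLen X => X.+1
  end.

(* Strictly above every free variable of either sort, but not tight: binders do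
   not decrement it. *)
Fixpoint fbound (A : form) : nat :=
  match A with
  | FBot => 0
  | FEqN t u | FLe t u => maxn (tbound t) (tbound u)
  | FEqS X Y => maxn X.+1 Y.+1
  | FMem t X => maxn (tbound t) X.+1
  | FImp A B | FAnd A B | FOr A B => maxn (fbound A) (fbound B)
  | FAllN A | FExN A | FAllS A | FExS A => fbound A
  end.

Definition eq_below (T : Type) (k : nat) (f g : nat -> T) : Prop :=
  forall n, n < k -> f n = g n.

Lemma eq_below_maxl (T : Type) j k (f g : nat -> T) :
  eq_below (maxn j k) f g -> eq_below j f g.
Proof. by move=> E n ltn; apply: E; rewrite leq_max ltn. Qed.

Lemma eq_below_maxr (T : Type) j k (f g : nat -> T) :
  eq_below (maxn j k) f g -> eq_below k f g.
Proof. by move=> E n ltn; apply: E; rewrite leq_max ltn orbT. Qed.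

Lemma eq_below_scons (T : Type) k a (f g : nat -> T) :
  eq_below k f g -> eq_below k (scons a f) (scons a g).
Proof. by move=> E [|n] //= ltn; apply: E; apply: ltnW. Qed.

Lemma eq_below_comp (T U : Type) k (h : T -> U) (f g : nat -> T) :
  eq_below k f g -> eq_below k (fun n => h (f n)) (fun n => h (g n)).
Proof. by move=> E n ltn; rewrite E. Qed.

Lemma tsubst_below s s' r r' t :
  eq_below (tbound t) s s' -> eq_below (tbound t) r r' ->
  tsubst s r t = tsubst s' r' t.
Proof.
elim: t => //= [n|t IHt u IHu|t IHt u IHu|X] Es Er.
- exact: Es.
- by rewrite IHt ?IHu //; eauto using eq_below_maxl, eq_below_maxr.
- by rewrite IHt ?IHu //; eauto using eq_below_maxl, eq_below_maxr.
- by rewrite Er.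
Qed.

(** Binders are harmless although [fbound] ignores them: [scons] turns agreement below k into
    agreement below k + 1. This lets a finite part of a substitution stand for all of it. *)
Lemma fsubst_below s s' r r' A :
  eq_below (fbound A) s s' -> eq_below (fbound A) r r' ->
  fsubst s r A = fsubst s' r' A.
Proof.
elim: A s s' r r' => //=.
- by move=> t u s s' r r' Es Er; congr FEqN; apply: tsubst_below;
     eauto using eq_below_maxl, eq_below_maxr.
- by move=> X Y s s' r r' _ Er; rewrite !Er // leq_max leqnn ?orbT.
- by move=> t u s s' r r' Es Er; congr FLe; apply: tsubst_below;
     eauto using eq_below_maxl, eq_below_maxr.
- move=> t X s s' r r' Es Er; rewrite Er ?leq_max ?leqnn ?orbT //.
  by congr FMem; apply: tsubst_below; eauto using eq_below_maxl.
- by move=> A IHA B IHB s s' r r' Es Er; congr FImp; [apply: IHA|apply: IHB];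
     eauto using eq_below_maxl, eq_below_maxr.
- by move=> A IHA B IHB s s' r r' Es Er; congr FAnd; [apply: IHA|apply: IHB];
     eauto using eq_below_maxl, eq_below_maxr.
- by move=> A IHA B IHB s s' r r' Es Er; congr FOr; [apply: IHA|apply: IHB];
     eauto using eq_below_maxl, eq_below_maxr.
- by move=> A IHA s s' r r' Es Er; congr FAllN; apply: IHA => //;
     apply: eq_below_scons; apply: eq_below_comp.
- by move=> A IHA s s' r r' Es Er; congr FExN; apply: IHA => //;
     apply: eq_below_scons; apply: eq_below_comp.
- by move=> A IHA s s' r r' Es Er; congr FAllS; apply: IHA;
     [|apply: eq_below_scons]; apply: eq_below_comp.
- by move=> A IHA s s' r r' Es Er; congr FExS; apply: IHA;
     [|apply: eq_below_scons]; apply: eq_below_comp.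
Qed.

Lemma tsubst_ext s s' r r' t : s =1 s' -> r =1 r' -> tsubst s r t = tsubst s' r' t.
Proof. by move=> Es Er; apply: tsubst_below => n _. Qed.

Lemma fsubst_ext s s' r r' A : s =1 s' -> r =1 r' -> fsubst s r A = fsubst s' r' A.
Proof. by move=> Es Er; apply: fsubst_below => n _. Qed.

Lemma tsubst_comp s' r' s r t :
  tsubst s' r' (tsubst s r t) =
  tsubst (fun n => tsubst s' r' (s n)) (fun n => r' (r n)) t.
Proof. by elim: t => //= t -> u ->. Qed.

Lemma tsubst_shiftN s r t : tsubst (upN s) r (shiftN t) = shiftN (tsubst s r t).
Proof. by rewrite /shiftN !tsubst_comp; apply: tsubst_ext. Qed.

Lemma tsubst_shiftS s r t :
  tsubst (fun n => shiftS (s n)) (upS r) (shiftS t) = shiftS (tsubst s r t).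
Proof. by rewrite /shiftS !tsubst_comp; apply: tsubst_ext. Qed.

Lemma fsubst_comp s' r' s r A :
  fsubst s' r' (fsubst s r A) =
  fsubst (fun n => tsubst s' r' (s n)) (fun n => r' (r n)) A.
Proof.
elim: A s' r' s r => //=.
- by move=> t u *; rewrite !tsubst_comp.
- by move=> t u *; rewrite !tsubst_comp.
- by move=> t X *; rewrite tsubst_comp.
- by move=> A IHA B IHB *; rewrite IHA IHB.
- by move=> A IHA B IHB *; rewrite IHA IHB.
- by move=> A IHA B IHB *; rewrite IHA IHB.
- by move=> A IHA s' r' s r; rewrite IHA; congr FAllN;
     apply: fsubst_ext => // -[|n] //=; rewrite tsubst_shiftN.
- by move=> A IHA s' r' s r; rewrite IHA; congr FExN;
     apply: fsubst_ext => // -[|n] //=; rewrite tsubst_shiftN.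
- by move=> A IHA s' r' s r; rewrite IHA; congr FAllS;
     apply: fsubst_ext => [n|[|n]] //=; rewrite tsubst_shiftS.
- by move=> A IHA s' r' s r; rewrite IHA; congr FExS;
     apply: fsubst_ext => [n|[|n]] //=; rewrite tsubst_shiftS.
Qed.

Lemma tsubst_id t : tsubst NVar id t = t.
Proof. by elim: t => //= t -> u ->. Qed.

Lemma fsubst_id A : fsubst NVar id A = A.
Proof.
have upN_id: upN NVar =1 NVar by case.
have upS_id: upS id =1 id by case.
elim: A => //=.
- by move=> t u; rewrite !tsubst_id.
- by move=> t u; rewrite !tsubst_id.
- by move=> t X; rewrite tsubst_id.
- by move=> A -> B ->.
- by move=> A -> B ->.
- by move=> A -> B ->.
- by move=> A E; rewrite (fsubst_ext _ upN_id (frefl _)) E.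
- by move=> A E; rewrite (fsubst_ext _ upN_id (frefl _)) E.
- by move=> A E; rewrite (@fsubst_ext _ NVar _ id) ?E.
- by move=> A E; rewrite (@fsubst_ext _ NVar _ id) ?E.
Qed.

Lemma tsubst_shift_scons a s r t : tsubst (scons a s) r (shiftN t) = tsubst s r t.
Proof. by rewrite /shiftN tsubst_comp; apply: tsubst_ext. Qed.

Lemma fsubst_instN s r A t :
  fsubst s r (instN A t) = instN (fsubst (upN s) r A) (tsubst s r t).
Proof.
rewrite /instN !fsubst_comp; apply: fsubst_ext => // -[|n] //=.
by rewrite tsubst_shift_scons tsubst_id.
Qed.

Lemma fsubst_instS s r A X :
  fsubst s r (instS A X) =
  instS (fsubst (fun n => shiftS (s n)) (upS r) A) (r X).
Proof.
rewrite /instS !fsubst_comp; apply: fsubst_ext => [n|[|n]] //=.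
by rewrite /shiftS tsubst_comp tsubst_id.
Qed.

Lemma fsubst_fshiftN s r A : fsubst (upN s) r (fshiftN A) = fshiftN (fsubst s r A).
Proof. by rewrite /fshiftN !fsubst_comp; apply: fsubst_ext. Qed.

Lemma fsubst_fshiftS s r A :
  fsubst (fun n => shiftS (s n)) (upS r) (fshiftS A) = fshiftS (fsubst s r A).
Proof. by rewrite /fshiftS !fsubst_comp; apply: fsubst_ext. Qed.

Lemma instN_up s r A t :
  instN (fsubst (upN s) r A) t = fsubst (scons t s) r A.
Proof.
rewrite /instN fsubst_comp; apply: fsubst_ext => // -[|n] //=.
by rewrite tsubst_shift_scons tsubst_id.
Qed.

Lemma instS_up s r A X :
  instS (fsubst (fun n => shiftS (s n)) (upS r) A) X = fsubst s (scons X r) A.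
Proof.
rewrite /instS fsubst_comp; apply: fsubst_ext => [n|[|n]] //=.
by rewrite /shiftS tsubst_comp tsubst_id.
Qed.

Lemma In_map (T U : Type) (f : T -> U) x s : List.In x s -> List.In (f x) (map f s).
Proof. by elim: s => //= y s IH [->|/IH]; [left|right]. Qed.

Lemma map_incl (T U : Type) (f : T -> U) s s' :
  List.incl s s' -> List.incl (map f s) (map f s').
Proof.
by elim: s => [_ x []|y s IH] /= sub x [<-|];
   [apply/In_map/sub; left|apply: IH => z zs; apply: sub; right].
Qed.

Lemma incl_cons2 (T : Type) (x : T) s s' :
  List.incl s s' -> List.incl (x :: s) (x :: s').
Proof. by move=> sub y [->|/sub]; [left|right]. Qed.

(** * Derivations *)

Section Provability.
Variable T : form -> Prop.
Implicit Types (G : seq form) (A B C : form).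

Lemma prov_weak G G' A : List.incl G G' -> prov T G A -> prov T G' A.
Proof.
move=> sub prA; elim: prA G' sub => {G A}.
- by move=> G A TA G' _; apply: P_ax.
- by move=> G A inA G' sub; apply: P_hyp; apply: sub.
- by move=> G A _ IH G' sub; apply: P_raa; apply/IH/incl_cons2.
- by move=> G A B _ IH G' sub; apply: P_impI; apply/IH/incl_cons2.
- by move=> G A B _ IH1 _ IH2 G' sub; apply: P_impE (IH1 _ sub) (IH2 _ sub).
- by move=> G A B _ IH1 _ IH2 G' sub; apply: P_andI (IH1 _ sub) (IH2 _ sub).
- by move=> G A B _ IH G' sub; apply: P_andEl (IH _ sub).
- by move=> G A B _ IH G' sub; apply: P_andEr (IH _ sub).
- by move=> G A B _ IH G' sub; apply: P_orIl (IH _ sub).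
- by move=> G A B _ IH G' sub; apply: P_orIr (IH _ sub).
- move=> G A B C _ IH1 _ IH2 _ IH3 G' sub.
  by apply: P_orE (IH1 _ sub) (IH2 _ _) (IH3 _ _); apply: incl_cons2.
- by move=> G A _ IH G' sub; apply: P_allNI; apply/IH/map_incl.
- by move=> G A t _ IH G' sub; apply: P_allNE (IH _ sub).
- by move=> G A t _ IH G' sub; apply: P_exNI (IH _ sub).
- move=> G A C _ IH1 _ IH2 G' sub.
  by apply: P_exNE (IH1 _ sub) (IH2 _ _); apply/incl_cons2/map_incl.
- by move=> G A _ IH G' sub; apply: P_allSI; apply/IH/map_incl.
- by move=> G A t _ IH G' sub; apply: P_allSE (IH _ sub).
- by move=> G A t _ IH G' sub; apply: P_exSI (IH _ sub).
- move=> G A C _ IH1 _ IH2 G' sub.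
  by apply: P_exSE (IH1 _ sub) (IH2 _ _); apply/incl_cons2/map_incl.
- by move=> G t G' _; apply: P_eqN_refl.
- by move=> G A t u _ IH1 _ IH2 G' sub; apply: P_eqN_subst (IH1 _ sub) (IH2 _ sub).
- by move=> G t G' _; apply: P_eqS_refl.
- by move=> G A t u _ IH1 _ IH2 G' sub; apply: P_eqS_subst (IH1 _ sub) (IH2 _ sub).
Qed.

Lemma prov_weak1 G A B : prov T G B -> prov T (A :: G) B.
Proof. by apply: prov_weak => C inC; right. Qed.

Lemma prov_hyp0 G A : prov T (A :: G) A.
Proof. by apply: P_hyp; left. Qed.

Lemma prov_absurd G A : prov T G FBot -> prov T G A.
Proof. by move=> prF; apply: P_raa; apply: prov_weak1. Qed.

(** The classical direction of quantifier duality: in the Henkin set it gives a rejected universal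
    formula a counterexample. *)
Lemma prov_not_all_exN G A : prov T (FNot (FAllN A) :: G) (FExN (FNot A)).
Proof.
apply: P_raa; apply: (P_impE (A := FAllN A)); first by apply: P_hyp; right; left.
apply: P_allNI; apply: P_raa.
apply: (P_impE (A := fshiftN (FExN (FNot A)))).
  by apply: P_hyp; right; left.
apply: (P_exNI (t := NVar 0)) => /=.
(* Instantiating the shifted body at the eigenvariable undoes the shift. *)
rewrite (_ : instN _ _ = FNot A); first exact: prov_hyp0.
rewrite -[RHS]fsubst_id /instN.
rewrite (_ : FImp _ _ = fsubst (upN (fun n => NVar n.+1)) id (FNot A)) //.
by rewrite fsubst_comp; apply: fsubst_ext => // -[|n].
Qed.

Lemma prov_not_all_exS G A : prov T (FNot (FAllS A) :: G) (FExS (FNot A)).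
Proof.
apply: P_raa; apply: (P_impE (A := FAllS A)); first by apply: P_hyp; right; left.
apply: P_allSI; apply: P_raa.
apply: (P_impE (A := fshiftS (FExS (FNot A)))).
  by apply: P_hyp; right; left.
apply: (P_exSI (X := 0)) => /=.
rewrite (_ : instS _ _ = FNot A); first exact: prov_hyp0.
rewrite -[RHS]fsubst_id /instS.
rewrite (_ : FImp _ _ = fsubst NVar (upS S) (FNot A)) //.
by rewrite fsubst_comp; apply: fsubst_ext => // -[|n].
Qed.

Lemma foldr_scons_shift (U : Type) (f : nat -> U) us n :
  foldr (@scons U) f us (size us + n) = f n.
Proof. by elim: us => //= u us ->. Qed.

Lemma foldr_scons_mkseq (U : Type) (f g : nat -> U) k :
  eq_below k (foldr (@scons U) f (mkseq g k)) g.
Proof.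
rewrite /mkseq => n ltnk.
suff H m: n < k -> foldr (@scons U) f (map g (iota m k)) n = g (m + n).
  by rewrite H.
elim: k n m {ltnk} => // k IH [|n] m /= ltnk; first by rewrite addn0.
by rewrite IH // addSnnS.
Qed.

(* The axioms hold under any hypotheses, hence for generic variables: they can
   be generalised and instantiated, one variable at a time. *)
Lemma prov_inst_seqN ts A : (forall G, prov T G A) ->
  forall G, prov T G (fsubst (foldr (@scons _) NVar ts) id A).
Proof.
elim: ts A => [|t ts IH] A prA G /=; first by rewrite fsubst_id.
(* The terms [ts] are instantiated after [t], while the substitution is simultaneous; moving the
   variables of [t] past [size ts] protects them. *)
pose t' := tsubst (fun n => NVar (size ts + n)) id t.
have prA' G': prov T G' (instN A t') by apply: P_allNE; apply: P_allNI.
have := IH _ prA' G; rewrite /instN fsubst_comp.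
rewrite (@fsubst_ext _ (scons t (foldr (@scons _) NVar ts)) _ id) // => -[|n] //=.
rewrite tsubst_comp -[RHS]tsubst_id; apply: tsubst_ext => // n /=.
exact: foldr_scons_shift.
Qed.

Lemma prov_inst_seqS Xs A : (forall G, prov T G A) ->
  forall G, prov T G (fsubst NVar (foldr (@scons _) id Xs) A).
Proof.
elim: Xs A => [|X Xs IH] A prA G /=; first by rewrite fsubst_id.
have prA' G': prov T G' (instS A (size Xs + X)) by apply: P_allSE; apply: P_allSI.
have := IH _ prA' G; rewrite /instS fsubst_comp.
rewrite (@fsubst_ext _ NVar _ (scons X (foldr (@scons _) id Xs))) // => -[|n] //=.
exact: foldr_scons_shift.
Qed.

(** Only variables below [fbound A] matter, so finitely many instantiations suffice. Strings go
    first: the terms in [s] may mention string variables, which a later string substitution would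
    alter. *)
Lemma prov_inst A s r : (forall G, prov T G A) -> forall G, prov T G (fsubst s r A).
Proof.
move=> prA G.
have prA' := prov_inst_seqS (mkseq r (fbound A)) prA.
have := prov_inst_seqN (mkseq s (fbound A)) prA' G.
rewrite fsubst_comp (@fsubst_below _ s _ r) //; exact: foldr_scons_mkseq.
Qed.

(** Each rule commutes with substitution. Instances of an axiom need not be axioms, so that case
    rests on [prov_inst]. *)
Lemma prov_fsubst G A s r :
  prov T G A -> prov T (map (fsubst s r) G) (fsubst s r A).
Proof.
have mapN s' r' G' : map (fsubst (upN s') r') (map fshiftN G') =
    map fshiftN (map (fsubst s' r') G').
  by rewrite -!map_comp; apply: eq_map => B /=; apply: fsubst_fshiftN.
have mapS s' r' G' :
    map (fsubst (fun n => shiftS (s' n)) (upS r')) (map fshiftS G') =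
    map fshiftS (map (fsubst s' r') G').
  by rewrite -!map_comp; apply: eq_map => B /=; apply: fsubst_fshiftS.
move=> prA; elim: prA s r => {G A}.
- by move=> G A TA s r; apply: prov_inst => G'; apply: P_ax.
- by move=> G A inA s r; apply/P_hyp/In_map.
- by move=> G A _ IH s r; apply: P_raa (IH s r).
- by move=> G A B _ IH s r; apply: P_impI (IH s r).
- by move=> G A B _ IH1 _ IH2 s r; apply: P_impE (IH1 s r) (IH2 s r).
- by move=> G A B _ IH1 _ IH2 s r; apply: P_andI (IH1 s r) (IH2 s r).
- by move=> G A B _ IH s r; apply: P_andEl (IH s r).
- by move=> G A B _ IH s r; apply: P_andEr (IH s r).
- by move=> G A B _ IH s r; apply: P_orIl (IH s r).
- by move=> G A B _ IH s r; apply: P_orIr (IH s r).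
- by move=> G A B C _ IH1 _ IH2 _ IH3 s r; apply: P_orE (IH1 s r) (IH2 s r) (IH3 s r).
- by move=> G A _ IH s r; apply: P_allNI; rewrite -mapN; apply: IH.
- by move=> G A t _ IH s r; rewrite fsubst_instN; apply: P_allNE (IH s r).
- move=> G A t _ IH s r; apply: (P_exNI (t := tsubst s r t)).
  by rewrite -fsubst_instN.
- move=> G A C _ IH1 _ IH2 s r; apply: P_exNE (IH1 s r) _.
  by have := IH2 (upN s) r; rewrite /= mapN fsubst_fshiftN.
- by move=> G A _ IH s r; apply: P_allSI; rewrite -mapS; apply: IH.
- by move=> G A X _ IH s r; rewrite fsubst_instS; apply: P_allSE (IH s r).
- by move=> G A X _ IH s r; apply: (P_exSI (X := r X)); rewrite -fsubst_instS.
- move=> G A C _ IH1 _ IH2 s r; apply: P_exSE (IH1 s r) _.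
  by have := IH2 (fun n => shiftS (s n)) (upS r); rewrite /= mapS fsubst_fshiftS.
- by move=> G t s r; apply: P_eqN_refl.
- move=> G A t u _ IH1 _ IH2 s r; rewrite fsubst_instN.
  by apply: P_eqN_subst (IH1 s r) _; rewrite -fsubst_instN.
- by move=> G X s r; apply: P_eqS_refl.
- move=> G A X Y _ IH1 _ IH2 s r; rewrite fsubst_instS.
  by apply: P_eqS_subst (IH1 s r) _; rewrite -fsubst_instS.
Qed.

Definition consistent G : Prop := ~ prov T G FBot.

Fixpoint gbound G : nat :=
  if G is A :: G' then maxn (fbound A) (gbound G') else 0.

Lemma map_fsubst_gbound s s' r r' k G : gbound G <= k ->
  eq_below k s s' -> eq_below k r r' -> map (fsubst s r) G = map (fsubst s' r') G.
Proof.
elim: G => //= A G IH; rewrite geq_max => /andP[leA leG] Es Er.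
rewrite (@fsubst_below s s' r r') ?IH // => n ltn; [apply: Es|apply: Er];
  exact: leq_trans leA.
Qed.

Lemma consistent_witnessN G A k : fbound A <= k -> gbound G <= k ->
  List.In (FExN A) G -> consistent G -> consistent (instN A (NVar k) :: G).
Proof.
move=> leA leG inA conG prF; apply: conG.
apply: (P_exNE (P_hyp T inA)) => /=.
(* [s] sends the fresh variable k to the eigenvariable of [P_exNE] and shifts the others, so it acts
   on [G] as [fshiftN] and turns [instN A (NVar k)] back into [A]. *)
pose s n := if n == k then NVar 0 else NVar n.+1.
have := prov_fsubst s id prF; rewrite /= /instN fsubst_comp.
have Es: eq_below k s (fun n => NVar n.+1).
  by move=> n ltn; rewrite /s ltn_eqF.
rewrite (map_fsubst_gbound leG Es (fun _ _ => erefl)).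
rewrite (@fsubst_below _ NVar _ id) ?fsubst_id //.
by move=> [|n] ltn /=; [rewrite /s eqxx|apply: Es; apply: leq_trans leA; apply: ltnW].
Qed.

Lemma consistent_witnessS G A k : fbound A <= k -> gbound G <= k ->
  List.In (FExS A) G -> consistent G -> consistent (instS A k :: G).
Proof.
move=> leA leG inA conG prF; apply: conG.
apply: (P_exSE (P_hyp T inA)) => /=.
pose r n := if n == k then 0 else n.+1.
have := prov_fsubst NVar r prF; rewrite /= /instS fsubst_comp.
have Er: eq_below k r S by move=> n ltn; rewrite /r ltn_eqF.
rewrite (map_fsubst_gbound leG (fun _ _ => erefl) Er).
rewrite (@fsubst_below _ NVar _ id) ?fsubst_id //.
by move=> [|n] ltn /=; [rewrite /r eqxx|apply: Er; apply: leq_trans leA; apply: ltnW].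
Qed.

End Provability.

(** * Completeness *)

Fixpoint tcode (t : nterm) : GenTree.tree nat :=
  match t with
  | NVar n => GenTree.Leaf n
  | NZero => GenTree.Node 0 [::]
  | NOne => GenTree.Node 1 [::]
  | NAdd t u => GenTree.Node 2 [:: tcode t; tcode u]
  | NMul t u => GenTree.Node 3 [:: tcode t; tcode u]
  | NLen X => GenTree.Node 4 [:: GenTree.Leaf X]
  end.

Fixpoint tdecode (c : GenTree.tree nat) : nterm :=
  match c with
  | GenTree.Leaf n => NVar n
  | GenTree.Node 1 _ => NOne
  | GenTree.Node 2 [:: t; u] => NAdd (tdecode t) (tdecode u)
  | GenTree.Node 3 [:: t; u] => NMul (tdecode t) (tdecode u)
  | GenTree.Node 4 [:: GenTree.Leaf X] => NLen X
  | _ => NZero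
  end.

Lemma tcodeK : cancel tcode tdecode.
Proof. by elim=> //= t -> u ->. Qed.

Fixpoint fcode (A : form) : GenTree.tree nat :=
  match A with
  | FBot => GenTree.Node 0 [::]
  | FEqN t u => GenTree.Node 1 [:: tcode t; tcode u]
  | FEqS X Y => GenTree.Node 2 [:: GenTree.Leaf X; GenTree.Leaf Y]
  | FLe t u => GenTree.Node 3 [:: tcode t; tcode u]
  | FMem t X => GenTree.Node 4 [:: tcode t; GenTree.Leaf X]
  | FImp A B => GenTree.Node 5 [:: fcode A; fcode B]
  | FAnd A B => GenTree.Node 6 [:: fcode A; fcode B]
  | FOr A B => GenTree.Node 7 [:: fcode A; fcode B]
  | FAllN A => GenTree.Node 8 [:: fcode A]
  | FExN A => GenTree.Node 9 [:: fcode A]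
  | FAllS A => GenTree.Node 10 [:: fcode A]
  | FExS A => GenTree.Node 11 [:: fcode A]
  end.

Fixpoint fdecode (c : GenTree.tree nat) : form :=
  match c with
  | GenTree.Node 1 [:: t; u] => FEqN (tdecode t) (tdecode u)
  | GenTree.Node 2 [:: GenTree.Leaf X; GenTree.Leaf Y] => FEqS X Y
  | GenTree.Node 3 [:: t; u] => FLe (tdecode t) (tdecode u)
  | GenTree.Node 4 [:: t; GenTree.Leaf X] => FMem (tdecode t) X
  | GenTree.Node 5 [:: A; B] => FImp (fdecode A) (fdecode B)
  | GenTree.Node 6 [:: A; B] => FAnd (fdecode A) (fdecode B)
  | GenTree.Node 7 [:: A; B] => FOr (fdecode A) (fdecode B)
  | GenTree.Node 8 [:: A] => FAllN (fdecode A)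
  | GenTree.Node 9 [:: A] => FExN (fdecode A)
  | GenTree.Node 10 [:: A] => FAllS (fdecode A)
  | GenTree.Node 11 [:: A] => FExS (fdecode A)
  | _ => FBot
  end.

Lemma fcodeK : cancel fcode fdecode.
Proof.
elim=> //=; try by move=> t u; rewrite !tcodeK.
- by move=> A -> B ->.
- by move=> A -> B ->.
- by move=> A -> B ->.
- by move=> A ->.
- by move=> A ->.
- by move=> A ->.
- by move=> A ->.
Qed.

(** Junk codes give [FBot], which no consistent stage admits. *)
Definition form_of_nat (n : nat) : form :=
  if unpickle n is Some c then fdecode c else FBot.

Lemma form_of_nat_surj A : exists n, form_of_nat n = A.
Proof. by exists (pickle (fcode A)); rewrite /form_of_nat pickleK fcodeK. Qed.

(** * Two-sorted models and satisfaction *)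

Record model : Type := Model {
  num : Type;
  str : Type;
  mzero : num;
  mone : num;
  madd : num -> num -> num;
  mmul : num -> num -> num;
  mle : num -> num -> Prop;
  mlen : str -> num;
  mmem : num -> str -> Prop
}.

Section Satisfaction.
Variable M : model.

Fixpoint eval (e : nat -> num M) (r : nat -> str M) (t : nterm) : num M :=
  match t with
  | NVar n => e n
  | NZero => mzero M
  | NOne => mone M
  | NAdd t u => madd (eval e r t) (eval e r u)
  | NMul t u => mmul (eval e r t) (eval e r u)
  | NLen X => mlen (r X)
  end.

(** Equality is identity in the carriers, which forces the Henkin model to be a quotient. *)
Fixpoint sat (e : nat -> num M) (r : nat -> str M) (A : form) : Prop :=
  match A with
  | FBot => False
  | FEqN t u => eval e r t = eval e r u
  | FEqS X Y => r X = r Y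
  | FLe t u => mle (eval e r t) (eval e r u)
  | FMem t X => mmem (eval e r t) (r X)
  | FImp A B => sat e r A -> sat e r B
  | FAnd A B => sat e r A /\ sat e r B
  | FOr A B => sat e r A \/ sat e r B
  | FAllN A => forall a, sat (scons a e) r A
  | FExN A => exists a, sat (scons a e) r A
  | FAllS A => forall X, sat e (scons X r) A
  | FExS A => exists X, sat e (scons X r) A
  end.

Lemma scons_comp (T U : Type) (f : T -> U) a s :
  scons (f a) (fun n => f (s n)) = fun n => f (scons a s n).
Proof. by apply: functional_extensionality => -[]. Qed.

Lemma eval_tsubst e r s v t :
  eval e r (tsubst s v t) = eval (fun n => eval e r (s n)) (fun n => r (v n)) t.
Proof. by elim: t => //= t -> u ->. Qed.

Lemma eval_shiftN a e r t : eval (scons a e) r (shiftN t) = eval e r t.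
Proof. exact: eval_tsubst. Qed.

Lemma eval_shiftS X e r t : eval e (scons X r) (shiftS t) = eval e r t.
Proof. exact: eval_tsubst. Qed.

Lemma sat_fsubst e r s v A :
  sat e r (fsubst s v A) = sat (fun n => eval e r (s n)) (fun n => r (v n)) A.
Proof.
have envN a e' r' (s' : nat -> nterm) :
    (fun n => eval (scons a e') r' (upN s' n)) =
    scons a (fun n => eval e' r' (s' n)).
  by apply: functional_extensionality => -[|n] //=; apply: eval_shiftN.
have envS X e' r' (s' : nat -> nterm) :
    (fun n => eval e' (scons X r') (shiftS (s' n))) =
    fun n => eval e' r' (s' n).
  by apply: functional_extensionality => n; apply: eval_shiftS.
have envV X (r' : nat -> str M) (v' : nat -> nat) :
    (fun n => scons X r' (upS v' n)) = scons X (fun n => r' (v' n)).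
  by apply: functional_extensionality => -[|n].
elim: A e r s v => //=.
- by move=> t u *; rewrite !eval_tsubst.
- by move=> t u *; rewrite !eval_tsubst.
- by move=> t X *; rewrite !eval_tsubst.
- by move=> A IHA B IHB *; rewrite IHA IHB.
- by move=> A IHA B IHB *; rewrite IHA IHB.
- by move=> A IHA B IHB *; rewrite IHA IHB.
- move=> A IHA e r s v; apply: propositional_extensionality.
  by split=> H a; have := H a; rewrite IHA envN.
- move=> A IHA e r s v; apply: propositional_extensionality.
  by split=> -[a H]; exists a; move: H; rewrite IHA envN.
- move=> A IHA e r s v; apply: propositional_extensionality.
  by split=> H X; have := H X; rewrite IHA envS envV.
- move=> A IHA e r s v; apply: propositional_extensionality.
  by split=> -[X H]; exists X; move: H; rewrite IHA envS envV.
Qed.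

Lemma sat_fshiftS X e r A : sat e (scons X r) (fshiftS A) = sat e r A.
Proof. exact: sat_fsubst. Qed.

End Satisfaction.

(** * The Henkin construction *)

Section Henkin.
Variables (T : form -> Prop) (A0 : form).
Hypothesis con0 : consistent T [:: FNot A0].

(** Free variables act as the Henkin constants: a stage is a finite list, so [gbound G] is a
    variable, of either sort, fresh for all of it. *)
Definition add_witness (B : form) (G : seq form) : seq form :=
  match B with
  | FExN C => instN C (NVar (gbound G)) :: G
  | FExS C => instS C (gbound G) :: G
  | _ => G
  end.

Fixpoint stage (n : nat) : seq form :=
  if n is m.+1 then
    let B := form_of_nat m in
    if excluded_middle_informative (consistent T (B :: stage m))
    then add_witness B (B :: stage m) else stage m
  else [:: FNot A0].

Definition henkin (A : form) : Prop := exists n, List.In A (stage n).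

Lemma add_witness_incl B G : List.incl G (add_witness B G).
Proof. by case: B => * A inA //=; right. Qed.

Lemma stage_consistent n : consistent T (stage n).
Proof.
elim: n => //= n IH; case: excluded_middle_informative => // con.
case E: (form_of_nat n) con => //= [A|A] con.
- apply: consistent_witnessN => //; last by left.
  exact: (leq_maxl (fbound A)).
- apply: consistent_witnessS => //; last by left.
  exact: (leq_maxl (fbound A)).
Qed.

Lemma stageS_incl n : List.incl (stage n) (stage n.+1).
Proof.
move=> A inA /=; case: excluded_middle_informative => // con.
by apply: add_witness_incl; right.
Qed.

Lemma stage_incl m n : m <= n -> List.incl (stage m) (stage n).
Proof.
move/subnK <-; elim: (n - m) => [|k IH] A inA //.
by rewrite addSn; apply/stageS_incl/IH.
Qed.

(** The finitary half of compactness. The lower bound [m] makes the stage include stage [m] as well,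
    from which a rejected formula may have been refuted. *)
Lemma stage_sub_henkin G : (forall A, List.In A G -> henkin A) ->
  forall m, exists2 n, m <= n & List.incl G (stage n).
Proof.
elim: G => [_ m|A G IH hG m]; first by exists m => // B [].
have [|n1 le1 sub1] := IH _ m; first by move=> B inB; apply: hG; right.
have [|n2 in2] := hG A; first by left.
exists (maxn n1 n2); first exact: leq_trans le1 (leq_maxl _ _).
move=> B [<-|/sub1 inB]; last exact: stage_incl (leq_maxl _ _) _ inB.
exact: stage_incl (leq_maxr _ _) _ in2.
Qed.

Lemma henkin_decide A :
  exists n, [/\ form_of_nat n = A &
    List.incl (add_witness A (A :: stage n)) (stage n.+1)
    \/ prov T (stage n) (FNot A)].
Proof.
have [n En] := form_of_nat_surj A; exists n; split=> //=; rewrite En.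
case: excluded_middle_informative => con; first by left.
by right; apply: P_impI; apply: NNPP.
Qed.

Lemma henkin_prov G A :
  (forall B, List.In B G -> henkin B) -> prov T G A -> henkin A.
Proof.
move=> hG prA; have [n [_ [sub|prN]]] := henkin_decide A.
  by exists n.+1; apply/sub/add_witness_incl; left.
have [m lenm sub] := stage_sub_henkin hG n.
case: (@stage_consistent m); apply: (P_impE (A := A)).
  by apply: prov_weak prN; apply: stage_incl.
exact: prov_weak sub prA.
Qed.

Lemma henkin_bot : ~ henkin FBot.
Proof. by case=> n inF; apply: (@stage_consistent n); apply: P_hyp. Qed.

Lemma henkin_not A : henkin (FNot A) <-> ~ henkin A.
Proof.
split=> [hN hA|hA].
  apply: henkin_bot; apply: (@henkin_prov [:: FNot A; A]).
    by move=> B [<-|[<-|[]]].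
  by apply: (P_impE (A := A)); apply: P_hyp; [left|right; left].
have [n [_ [sub|prN]]] := henkin_decide A.
  by case: hA; exists n.+1; apply/sub/add_witness_incl; left.
by apply: henkin_prov prN => B inB; exists n.
Qed.

Lemma henkin1 A B : (forall G, prov T (A :: G) B) -> henkin A -> henkin B.
Proof. by move=> prB hA; apply: henkin_prov (prB [::]) => C [<-|[]]. Qed.

Lemma henkin2 A B C :
  (forall G, prov T (A :: B :: G) C) -> henkin A -> henkin B -> henkin C.
Proof. by move=> prC hA hB; apply: henkin_prov (prC [::]) => D [<-|[<-|[]]]. Qed.

Lemma henkin0 A : (forall G, prov T G A) -> henkin A.
Proof. by move=> prA; apply: henkin_prov (prA [::]) => D []. Qed.

Lemma henkin_and A B : henkin (FAnd A B) <-> henkin A /\ henkin B.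
Proof.
split=> [h|[]].
  split; apply: henkin1 h => G; [apply: P_andEl|apply: P_andEr]; exact: prov_hyp0.
by apply: henkin2 => G; apply: P_andI; [|apply: prov_weak1]; apply: prov_hyp0.
Qed.

Lemma henkin_imp A B : henkin (FImp A B) <-> (henkin A -> henkin B).
Proof.
split=> [h hA|h].
  apply: henkin2 h hA => G.
  by apply: (P_impE (A := A)); [|apply: prov_weak1]; apply: prov_hyp0.
case: (classic (henkin A)) => [/h|/henkin_not]; apply: henkin1 => G; apply: P_impI.
  by apply: prov_weak1; apply: prov_hyp0.
apply: prov_absurd; apply: (P_impE (A := A)); last exact: prov_hyp0.
by apply: prov_weak1; apply: prov_hyp0.
Qed.

Lemma henkin_or A B : henkin (FOr A B) <-> henkin A \/ henkin B.
Proof.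
split=> [h|[]].
- apply: NNPP => hn; apply: henkin_bot.
  have /henkin_not hA: ~ henkin A by move=> hA; apply: hn; left.
  have /henkin_not hB: ~ henkin B by move=> hB; apply: hn; right.
  have prF G: prov T (FOr A B :: FNot A :: FNot B :: G) FBot.
    apply: (P_orE (A := A) (B := B)); first exact: prov_hyp0.
      by apply: (P_impE (A := A)); apply: P_hyp; [right; right|]; left.
    by apply: (P_impE (A := B)); apply: P_hyp; [right; right; right|]; left.
  by apply: henkin_prov (prF [::]) => C [<-|[<-|[<-|[]]]].
- by apply: henkin1 => G; apply: P_orIl; apply: prov_hyp0.
- by apply: henkin1 => G; apply: P_orIr; apply: prov_hyp0.
Qed.

Lemma henkin_exN A : henkin (FExN A) <-> exists t, henkin (instN A t).
Proof.
split=> [h|[t]]; last first.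
  by apply: henkin1 => G; apply: P_exNI; apply: prov_hyp0.
have [n [_ [sub|prN]]] := henkin_decide (FExN A).
  by eexists; exists n.+1; apply: sub; left; reflexivity.
have /henkin_not[] // : henkin (FNot (FExN A)).
by apply: henkin_prov prN => B inB; exists n.
Qed.

Lemma henkin_exS A : henkin (FExS A) <-> exists X, henkin (instS A X).
Proof.
split=> [h|[t]]; last first.
  by apply: henkin1 => G; apply: P_exSI; apply: prov_hyp0.
have [n [_ [sub|prN]]] := henkin_decide (FExS A).
  by eexists; exists n.+1; apply: sub; left; reflexivity.
have /henkin_not[] // : henkin (FNot (FExS A)).
by apply: henkin_prov prN => B inB; exists n.
Qed.

Lemma henkin_allN A : henkin (FAllN A) <-> forall t, henkin (instN A t).
Proof.
split=> [h t|h].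
  by apply: henkin1 h => G; apply: P_allNE; apply: prov_hyp0.
apply: NNPP => /henkin_not hn.
have /henkin_exN[t /henkin_not] := henkin1 (fun G => prov_not_all_exN T G A) hn.
by apply; apply: h.
Qed.

Lemma henkin_allS A : henkin (FAllS A) <-> forall X, henkin (instS A X).
Proof.
split=> [h t|h].
  by apply: henkin1 h => G; apply: P_allSE; apply: prov_hyp0.
apply: NNPP => /henkin_not hn.
have /henkin_exS[t /henkin_not] := henkin1 (fun G => prov_not_all_exS T G A) hn.
by apply; apply: h.
Qed.

Definition eqn t u := henkin (FEqN t u).
Definition eqs X Y := henkin (FEqS X Y).

Lemma henkin_substN A t u : eqn t u -> henkin (instN A t) -> henkin (instN A u).
Proof.
move=> e h; apply: henkin2 e h => G; apply: (P_eqN_subst (t := t)).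
  exact: prov_hyp0.
by apply: prov_weak1; apply: prov_hyp0.
Qed.

Lemma henkin_substS A X Y : eqs X Y -> henkin (instS A X) -> henkin (instS A Y).
Proof.
move=> e h; apply: henkin2 e h => G; apply: (P_eqS_subst (X := X)).
  exact: prov_hyp0.
by apply: prov_weak1; apply: prov_hyp0.
Qed.

Lemma eqn_refl t : eqn t t.
Proof. by apply: henkin0 => G; apply: P_eqN_refl. Qed.

Lemma eqs_refl X : eqs X X.
Proof. by apply: henkin0 => G; apply: P_eqS_refl. Qed.

Lemma instN_shift t u : tsubst (scons u NVar) id (shiftN t) = t.
Proof. by rewrite tsubst_shift_scons tsubst_id. Qed.

Lemma eqn_sym t u : eqn t u -> eqn u t.
Proof.
move=> e; have := henkin_substN (A := FEqN (NVar 0) (shiftN t)) e.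
by rewrite /instN /= !instN_shift; apply; apply: eqn_refl.
Qed.

Lemma eqn_trans t u v : eqn t u -> eqn u v -> eqn t v.
Proof.
move=> e1 e2; have := henkin_substN (A := FEqN (shiftN t) (NVar 0)) e2.
by rewrite /instN /= !instN_shift; apply.
Qed.

Lemma eqs_sym X Y : eqs X Y -> eqs Y X.
Proof.
move=> e; exact: (henkin_substS (A := FEqS 0 X.+1) e (eqs_refl X)).
Qed.

Lemma eqs_trans X Y Z : eqs X Y -> eqs Y Z -> eqs X Z.
Proof. by move=> e1 e2; apply: (henkin_substS (A := FEqS X.+1 0) e2). Qed.

(** Canonical representatives in place of quotient classes: by extensionality the predicates [eqn t]
    and [eqn u] are equal when [t] and [u] are, so [epsilon] picks the same term for both. *)
Definition cname (t : nterm) : nterm := epsilon (inhabits t) (eqn t).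
Definition sname (X : nat) : nat := epsilon (inhabits X) (eqs X).

Lemma cnameP t : eqn t (cname t).
Proof. by apply: epsilon_spec; exists t; apply: eqn_refl. Qed.

Lemma snameP X : eqs X (sname X).
Proof. by apply: epsilon_spec; exists X; apply: eqs_refl. Qed.

Lemma cname_eq t u : cname t = cname u <-> eqn t u.
Proof.
split=> [E|e].
  by apply: eqn_trans (cnameP t) _; rewrite E; apply/eqn_sym/cnameP.
have E: eqn t = eqn u.
  apply: functional_extensionality => v; apply: propositional_extensionality.
  by split; apply: eqn_trans => //; apply: eqn_sym.
rewrite /cname E; apply: epsilon_inh_irrelevance.
by exists u; apply: eqn_refl.
Qed.

Lemma sname_eq X Y : sname X = sname Y <-> eqs X Y.
Proof.
split=> [E|e].
  by apply: eqs_trans (snameP X) _; rewrite E; apply/eqs_sym/snameP.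
have E: eqs X = eqs Y.
  apply: functional_extensionality => Z; apply: propositional_extensionality.
  by split; apply: eqs_trans => //; apply: eqs_sym.
rewrite /sname E; apply: epsilon_inh_irrelevance.
by exists Y; apply: eqs_refl.
Qed.

Definition cnum := {t | cname t = t}.
Definition cstr := {X | sname X = X}.

Lemma cname_idem t : cname (cname t) = cname t.
Proof. by apply/cname_eq/eqn_sym/cnameP. Qed.

Lemma sname_idem X : sname (sname X) = sname X.
Proof. by apply/sname_eq/eqs_sym/snameP. Qed.

Definition cnum_of t : cnum := exist _ (cname t) (cname_idem t).
Definition cstr_of X : cstr := exist _ (sname X) (sname_idem X).

Lemma cnum_of_val (a : cnum) : cnum_of (sval a) = a.
Proof. by apply: eq_sig_hprop => [t p q|]; [apply: proof_irrelevance|case: a]. Qed.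

Lemma cstr_of_val (X : cstr) : cstr_of (sval X) = X.
Proof. by apply: eq_sig_hprop => [t p q|]; [apply: proof_irrelevance|case: X]. Qed.

Lemma cnum_of_eq t u : cnum_of t = cnum_of u <-> eqn t u.
Proof.
rewrite -cname_eq; split=> [[]|E] //.
by apply: eq_sig_hprop => [v p q|] //; apply: proof_irrelevance.
Qed.

Lemma cstr_of_eq X Y : cstr_of X = cstr_of Y <-> eqs X Y.
Proof.
rewrite -sname_eq; split=> [[]|E] //.
by apply: eq_sig_hprop => [v p q|] //; apply: proof_irrelevance.
Qed.

Definition henkin_model : model := {|
  num := cnum;
  str := cstr;
  mzero := cnum_of NZero;
  mone := cnum_of NOne;
  madd a b := cnum_of (NAdd (sval a) (sval b));
  mmul a b := cnum_of (NMul (sval a) (sval b));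
  mle a b := henkin (FLe (sval a) (sval b));
  mlen X := cnum_of (NLen (sval X));
  mmem a X := henkin (FMem (sval a) (sval X))
|}.

Lemma eqn_substN t a b : eqn a b ->
  eqn (tsubst (scons a NVar) id t) (tsubst (scons b NVar) id t).
Proof.
move=> e; pose A := FEqN (shiftN (tsubst (scons a NVar) id t)) t.
have := henkin_substN (A := A) e.
by rewrite /instN /= !instN_shift; apply; apply: eqn_refl.
Qed.

Lemma eval_henkin (s : nat -> nterm) (r : nat -> nat) t :
  @eval henkin_model (fun n => cnum_of (s n)) (fun n => cstr_of (r n)) t =
  cnum_of (tsubst s r t).
Proof.
elim: t => //= [t -> u ->|t -> u ->|X]; apply/cnum_of_eq.
- apply: (@eqn_trans _ (NAdd (tsubst s r t) (cname (tsubst s r u)))).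
    have := eqn_substN (NAdd (NVar 0) (shiftN (cname (tsubst s r u))))
      (eqn_sym (cnameP (tsubst s r t))).
    by rewrite /= !instN_shift.
  have := eqn_substN (NAdd (shiftN (tsubst s r t)) (NVar 0))
    (eqn_sym (cnameP (tsubst s r u))).
  by rewrite /= !instN_shift.
- apply: (@eqn_trans _ (NMul (tsubst s r t) (cname (tsubst s r u)))).
    have := eqn_substN (NMul (NVar 0) (shiftN (cname (tsubst s r u))))
      (eqn_sym (cnameP (tsubst s r t))).
    by rewrite /= !instN_shift.
  have := eqn_substN (NMul (shiftN (tsubst s r t)) (NVar 0))
    (eqn_sym (cnameP (tsubst s r u))).
  by rewrite /= !instN_shift.
- exact: (henkin_substS (A := FEqN (NLen 0) (NLen (r X).+1))
    (snameP (r X)) (eqn_refl _)).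
Qed.

(** The truth lemma. It ranges over all substitutions because a quantifier extends the environment
    by an arbitrary class, whose representative [instN_up] and [instS_up] absorb into the
    substitution. *)
Lemma sat_henkin s r A :
  @sat henkin_model (fun n => cnum_of (s n)) (fun n => cstr_of (r n)) A <->
  henkin (fsubst s r A).
Proof.
have le_cname t u : henkin (FLe (cname t) (cname u)) <-> henkin (FLe t u).
  have H a b c d : eqn a b -> eqn c d -> henkin (FLe a c) -> henkin (FLe b d).
    move=> e1 e2 h; have := henkin_substN (A := FLe (NVar 0) (shiftN c)) e1.
    rewrite /instN /= !instN_shift => /(_ h) h1.
    have := henkin_substN (A := FLe (shiftN b) (NVar 0)) e2.
    by rewrite /instN /= !instN_shift; apply.
  by split; apply: H; try exact: cnameP; apply/eqn_sym/cnameP.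
have mem_name t X : henkin (FMem (cname t) (sname X)) <-> henkin (FMem t X).
  have H a b Y Z : eqn a b -> eqs Y Z -> henkin (FMem a Y) -> henkin (FMem b Z).
    move=> e1 e2 h; have /(_ h) h1 := henkin_substN (A := FMem (NVar 0) Y) e1.
    have := henkin_substS (A := FMem (shiftS b) 0) e2.
    by rewrite /instS /= /shiftS !tsubst_comp !tsubst_id; apply.
  by split; apply: H; try exact: cnameP; try exact: snameP;
     [apply/eqn_sym/cnameP|apply/eqs_sym/snameP].
elim: A s r => /=.
- by move=> s r; split=> // /henkin_bot.
- by move=> t u s r; rewrite !eval_henkin; apply: cnum_of_eq.
- by move=> X Y s r; apply: cstr_of_eq.
- by move=> t u s r; rewrite !eval_henkin; apply: le_cname.
- by move=> t X s r; rewrite !eval_henkin; apply: mem_name.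
- by move=> A IHA B IHB s r; rewrite henkin_imp IHA IHB.
- by move=> A IHA B IHB s r; rewrite henkin_and IHA IHB.
- by move=> A IHA B IHB s r; rewrite henkin_or IHA IHB.
- move=> A IHA s r; rewrite henkin_allN; split=> H t.
    by rewrite instN_up; apply/IHA; rewrite -scons_comp; apply: H.
  by rewrite -(cnum_of_val t) scons_comp; apply/IHA; rewrite -instN_up; apply: H.
- move=> A IHA s r; rewrite henkin_exN; split=> -[t H]; last first.
    exists (cnum_of t).
    by rewrite scons_comp; apply/IHA; rewrite -instN_up; apply: H.
  exists (sval t).
  by rewrite instN_up; apply/IHA; rewrite -scons_comp cnum_of_val; apply: H.
- move=> A IHA s r; rewrite henkin_allS; split=> H X.
    by rewrite instS_up; apply/IHA; rewrite -scons_comp; apply: H.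
  by rewrite -(cstr_of_val X) scons_comp; apply/IHA; rewrite -instS_up; apply: H.
- move=> A IHA s r; rewrite henkin_exS; split=> -[X H]; last first.
    exists (cstr_of X).
    by rewrite scons_comp; apply/IHA; rewrite -instS_up; apply: H.
  exists (sval X).
  by rewrite instS_up; apply/IHA; rewrite -scons_comp cstr_of_val; apply: H.
Qed.

Lemma henkin_model_axioms A : T A -> forall e r, @sat henkin_model e r A.
Proof.
move=> TA e r.
rewrite (_ : e = fun n => cnum_of (sval (e n))); last first.
  by apply: functional_extensionality => n; rewrite cnum_of_val.
rewrite (_ : r = fun n => cstr_of (sval (r n))); last first.
  by apply: functional_extensionality => n; rewrite cstr_of_val.
by apply/sat_henkin/henkin0/prov_inst => G; apply: P_ax.
Qed.

Lemma henkin_model_counter :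
  exists e r, ~ @sat henkin_model e r A0.
Proof.
exists (fun n => cnum_of (NVar n)), (fun n => cstr_of n) => /sat_henkin.
by rewrite fsubst_id; apply/henkin_not; exists 0; left.
Qed.

End Henkin.

Definition models (T : form -> Prop) (M : model) : Prop :=
  forall A, T A -> forall e r, @sat M e r A.

Theorem completeness (T : form -> Prop) (A : form) :
  (forall M, models T M -> forall e r, @sat M e r A) -> prov T [::] A.
Proof.
move=> valid; apply: NNPP => nprA.
have con: consistent T [:: FNot A] by move/P_raa.
have [e [r []]] := henkin_model_counter con.
exact/valid/henkin_model_axioms.
Qed.

(** * Arithmetic in a model of V1 *)

Lemma SigmaB0_fsubst s r A : SigmaB0 A -> SigmaB0 (fsubst s r A).
Proof.
move=> SA; elim: SA s r => //=; try by constructor.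
- by move=> t B SB IH s r; rewrite tsubst_shiftN; apply: S0_all.
- by move=> t B SB IH s r; rewrite tsubst_shiftN; apply: S0_ex.
Qed.

Lemma SigmaB1_fsubst s r A : SigmaB1 A -> SigmaB1 (fsubst s r A).
Proof.
move=> SA; elim: SA s r => /= [B SB|t B SB IH] s r.
  by apply/S1_base/SigmaB0_fsubst.
by rewrite tsubst_shiftS; apply: S1_ex.
Qed.

Declare Scope mod_scope.
Delimit Scope mod_scope with M.
Notation "0" := (mzero _) : mod_scope.
Notation "1" := (mone _) : mod_scope.
Notation "2" := (madd (mone _) (mone _)) : mod_scope.
Notation "a + b" := (madd a b) : mod_scope.
Notation "a * b" := (mmul a b) : mod_scope.
Notation "a <= b" := (mle a b) : mod_scope.

Ltac sigma := repeat (first [apply: S1_ex | apply: S1_base | constructor]).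

Section Arithmetic.
Variable M : model.
Hypothesis HM : models V1 M.
(** Arbitrary environments that pad finite lists of parameters; near the end they hold the
    parameters of [phi]. *)
Variables (e0 : nat -> num M) (r0 : nat -> str M).

Local Open Scope mod_scope.
Implicit Types (a b c d i j k m n : num M) (X Y Z W F : str M).
Implicit Types (P : num M -> Prop).

Definition mlt a b : Prop := a <= b /\ (a = b -> False).
Local Notation "a < b" := (mlt a b) : mod_scope.

Lemma mB1 a : a + 1 = 0 -> False.
Proof. exact: (HM V1_B1 (scons a e0) r0). Qed.
Lemma mB2 a b : a + 1 = b + 1 -> a = b.
Proof. exact: (HM V1_B2 (scons a (scons b e0)) r0). Qed.
Lemma mB3 a : a + 0 = a.
Proof. exact: (HM V1_B3 (scons a e0) r0). Qed.
Lemma mB4 a b : a + (b + 1) = a + b + 1.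
Proof. exact: (HM V1_B4 (scons a (scons b e0)) r0). Qed.
Lemma mB5 a : a * 0 = 0.
Proof. exact: (HM V1_B5 (scons a e0) r0). Qed.
Lemma mB6 a b : a * (b + 1) = a * b + a.
Proof. exact: (HM V1_B6 (scons a (scons b e0)) r0). Qed.
Lemma mle_anti a b : a <= b -> b <= a -> a = b.
Proof. by move=> H K; apply: (HM V1_B7 (scons a (scons b e0)) r0). Qed.
Lemma mle_addr a b : a <= a + b.
Proof. exact: (HM V1_B8 (scons a (scons b e0)) r0). Qed.
Lemma mle0 a : 0 <= a.
Proof. exact: (HM V1_B9 (scons a e0) r0). Qed.
Lemma mle_total a b : a <= b \/ b <= a.
Proof. exact: (HM V1_B10 (scons a (scons b e0)) r0). Qed.
Lemma mltS a b : a < b + 1 <-> a <= b.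
Proof. by have [H K] := HM V1_B11 (scons a (scons b e0)) r0; split. Qed.
Lemma mpred a : a <> 0 -> exists2 b, b <= a & b + 1 = a.
Proof. by case/(HM V1_B12 (scons a e0) r0) => b []; exists b. Qed.
Lemma mem_lt a X : mmem a X -> a < mlen X.
Proof. exact: (HM V1_L1 (scons a (scons a e0)) (scons X r0)). Qed.
Lemma mem_last a X : a + 1 = mlen X -> mmem a X.
Proof. exact: (HM V1_L2 (scons a (scons a e0)) (scons X r0)). Qed.
Lemma str_ext X Y : mlen X = mlen Y ->
  (forall i, i < mlen X -> (mmem i X <-> mmem i Y)) -> X = Y.
Proof.
move=> El E; apply: (HM V1_SE e0 (scons X (scons Y r0))); split=> //=.
by move=> a _ ltaX; apply: E.
Qed.

Lemma comprehension A e r b : SigmaB1 A ->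
  exists Y, mlen Y <= b /\ forall i, i < b -> (mmem i Y <-> sat (scons i e) r A).
Proof.
move=> SA.
(* The axiom keeps its bound in number variable 1; the renaming skips it, so that [A] sees i
   followed directly by [e]. *)
pose A' := fsubst (scons (NVar 0) (fun p => NVar p.+2)) id A.
have [Y [lenY memY]] := HM (V1_Comp (SigmaB1_fsubst _ _ SA : SigmaB1 A')) e r b.
exists Y; split=> // i ltib.
have: mmem i Y <-> sat (scons i (scons b e)) (scons Y r) (fshiftS A').
  exact: memY i (proj1 ltib) ltib.
rewrite sat_fshiftS sat_fsubst (_ : (fun p => _) = scons i e) //.
by apply: functional_extensionality => -[|p].
Qed.

Lemma mle_refl a : a <= a.
Proof. by case: (mle_total a a). Qed.

Lemma mltSn a : a < a + 1.
Proof. exact/mltS/mle_refl. Qed.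

Lemma mleS_lt a b : a + 1 <= b -> a < b.
Proof.
move=> leSb; apply: NNPP => nlt.
have leba: b <= a.
  case: (mle_total a b) => // leab.
  rewrite (_ : a = b); first exact: mle_refl.
  by apply: NNPP => nab; apply: nlt.
by case/mltS: leba => leb nb; apply/nb/mle_anti.
Qed.

Lemma mlt_or_ge a b : a < b \/ b <= a.
Proof.
case: (mle_total a b) => [leab|]; last by right.
by case: (classic (a = b)) => [->|nab]; [right; apply: mle_refl|left].
Qed.

Lemma mlt0 a : ~ a < 0.
Proof. by case=> lea0; apply; apply: mle_anti (mle0 a). Qed.

(** The numbers below |X| with no element of [X] at or below them form a string [Y], and its length
    is the minimum: by L2 its last element is |Y| - 1, and by L1 |Y| itself is no longer in it. *)
Lemma str_min X a : mmem a X ->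
  exists m, mmem m X /\ forall k, k < m -> ~ mmem k X.
Proof.
move=> Xa; have nzX: mlen X <> 0.
  by move=> E; have := mem_lt Xa; rewrite E; apply: mlt0.
have [|Y [lenY memY]] := @comprehension (FAllLe (NVar 0) (~ FMem (NVar 0) 0%N))%F
  e0 (scons X r0) (mlen X); first by sigma.
case: (classic (mlen Y = 0)) => [E0|/mpred[z _ Ez]].
  exists 0; split=> [|k /mlt0//]; apply: NNPP => nX0.
  have lt0: 0 < mlen X by split; [apply: mle0|move/esym].
  have: mmem 0 Y.
    apply/(memY _ lt0) => /= k lek0 Xk; apply: nX0.
    by rewrite (mle_anti (mle0 k) lek0).
  by move/mem_lt; rewrite E0; apply: mlt0.
have Yz: mmem z Y by apply: mem_last.
have ltzX: z < mlen X by apply: mleS_lt; rewrite Ez.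
have /= nX := (proj1 (memY z ltzX)) Yz.
exists (z + 1); split=> [|k /mltS lekz]; last exact: nX.
have ltSz: z + 1 < mlen X.
  split=> [|E]; first by rewrite Ez.
  by apply: (nX z (mle_refl z)); apply: mem_last.
have nYS: ~ mmem (z + 1) Y.
  by move/mem_lt; rewrite Ez => -[_]; apply.
apply: NNPP => nXS; apply/nYS/(memY _ ltSz) => /= k lek Xk.
case: (classic (k = z + 1)) => [Ek|nk]; first by rewrite -Ek in nXS.
by apply: (nX k) => //; apply/mltS.
Qed.

(** The form in which induction is available: the property is cut out below b by some string. Unlike
    being [SigmaB1], this is closed under negation. *)
Definition representable b P : Prop :=
  exists Y, forall i, i < b -> (mmem i Y <-> P i).

(** A least counterexample up to n exists by [str_min] and is not 0. The conclusion is only at the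
    endpoint: reaching all smaller numbers takes transitivity of the order, which is itself derived
    by this induction. *)
Lemma ind_top n P : representable (n + 1) P ->
  P 0 -> (forall i, i < n -> P i -> P (i + 1)) -> P n.
Proof.
case=> Y memY P0 PS; apply: NNPP => nPn.
have [|X [lenX memX]] := @comprehension (~ FMem (NVar 0) 0%N)%F
  e0 (scons Y r0) (n + 1); first by sigma.
have {}memX i: i < n + 1 -> (mmem i X <-> ~ P i).
  by move=> lti; have := memX i lti; have := memY i lti; rewrite /=; tauto.
have /str_min[m [Xm minm]]: mmem n X by apply/memX => //; apply: mltSn.
have lemn: m <= n.
  case: (mlt_or_ge n m) => // ltnm; case: (minm n ltnm).
  by apply/memX => //; apply: mltSn.
have nPm: ~ P m by apply/memX => //; apply/mltS.
case: (classic (m = 0)) => [E|/mpred[k _ Ek]]; first by rewrite E in nPm.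
have ltkn: k < n by apply: mleS_lt; rewrite Ek.
have ltkm: k < m by rewrite -Ek; apply: mltSn.
apply: nPm; rewrite -Ek; apply: PS => //; apply: NNPP => nPk.
by apply: (minm k ltkm); apply/memX => //; apply/mltS; case: ltkn.
Qed.

Lemma induct A e r : SigmaB1 A -> sat (scons 0 e) r A ->
  (forall i, sat (scons i e) r A -> sat (scons (i + 1) e) r A) ->
  forall n, sat (scons n e) r A.
Proof.
move=> SA A0 AS n; apply: (ind_top (P := fun i => sat (scons i e) r A)) => //.
  by have [Y [_ memY]] := comprehension e r (n + 1) SA; exists Y.
by move=> i _; apply: AS.
Qed.

(** * Semiring laws and order *)

Lemma madd0 a : 0 + a = a.
Proof.
refine (@induct (0 + NVar 0 == NVar 0)%F e0 r0 _ _ _ a) => /=; first by sigma.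
  exact: mB3.
by move=> i E; rewrite mB4 E.
Qed.

Lemma maddS a b : a + 1 + b = a + b + 1.
Proof.
refine (@induct (NVar 1 + 1 + NVar 0 == NVar 1 + NVar 0 + 1)%F
  (scons a e0) r0 _ _ _ b) => /=; first by sigma.
  by rewrite !mB3.
by move=> i E; rewrite !mB4 E.
Qed.

Lemma maddC a b : a + b = b + a.
Proof.
refine (@induct (NVar 1 + NVar 0 == NVar 0 + NVar 1)%F
  (scons a e0) r0 _ _ _ b) => /=; first by sigma.
  by rewrite mB3 madd0.
by move=> i E; rewrite mB4 maddS E.
Qed.

Lemma maddA a b c : a + (b + c) = a + b + c.
Proof.
refine (@induct (NVar 1 + (NVar 2 + NVar 0) == NVar 1 + NVar 2 + NVar 0)%F
  (scons a (scons b e0)) r0 _ _ _ c) => /=; first by sigma.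
  by rewrite !mB3.
by move=> i E; rewrite !mB4 E.
Qed.

Lemma maddI a b c : a + c = b + c -> a = b.
Proof.
refine (@induct (NVar 1 + NVar 0 == NVar 2 + NVar 0 -> NVar 1 == NVar 2)%F
  (scons a (scons b e0)) r0 _ _ _ c) => /=; first by sigma.
  by rewrite !mB3.
by move=> i E; rewrite !mB4 => /mB2.
Qed.

Lemma mmul0 a : 0 * a = 0.
Proof.
refine (@induct (0 * NVar 0 == 0)%F e0 r0 _ _ _ a) => /=; first by sigma.
  exact: mB5.
by move=> i E; rewrite mB6 E mB3.
Qed.

Lemma mmulS a b : (a + 1) * b = a * b + b.
Proof.
refine (@induct ((NVar 1 + 1) * NVar 0 == NVar 1 * NVar 0 + NVar 0)%F
  (scons a e0) r0 _ _ _ b) => /=; first by sigma.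
  by rewrite !mB5 mB3.
by move=> i E; rewrite !mB6 E !mB4 -!(maddA (a * i)) (maddC i).
Qed.

Lemma mmulC a b : a * b = b * a.
Proof.
refine (@induct (NVar 1 * NVar 0 == NVar 0 * NVar 1)%F
  (scons a e0) r0 _ _ _ b) => /=; first by sigma.
  by rewrite mB5 mmul0.
by move=> i E; rewrite mB6 mmulS E.
Qed.

Lemma mmulDl a b c : (a + b) * c = a * c + b * c.
Proof.
refine (@induct ((NVar 1 + NVar 2) * NVar 0 == NVar 1 * NVar 0 + NVar 2 * NVar 0)%F
  (scons a (scons b e0)) r0 _ _ _ c) => /=; first by sigma.
  by rewrite !mB5 mB3.
move=> i E; rewrite !mB6 E -!maddA; congr (_ + _).
by rewrite !maddA (maddC a).
Qed.

Lemma mmulA a b c : a * (b * c) = a * b * c.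
Proof.
refine (@induct (NVar 1 * (NVar 2 * NVar 0) == NVar 1 * NVar 2 * NVar 0)%F
  (scons a (scons b e0)) r0 _ _ _ c) => /=; first by sigma.
  by rewrite !mB5.
move=> i E; rewrite !mB6 -E mmulC mmulDl; congr (_ + _); exact: mmulC.
Qed.

Lemma mmul1 a : 1 * a = a.
Proof. by rewrite -(madd0 1) mmulS mmul0 madd0. Qed.

Lemma mod_semi_ring : semi_ring_theory 0 1 (@madd M) (@mmul M) eq.
Proof.
split; [exact: madd0|exact: maddC|exact: maddA|exact: mmul1|exact: mmul0
       |exact: mmulC|exact: mmulA|exact: mmulDl].
Qed.
Add Ring mod_ring : mod_semi_ring.

(** B8 gives one direction. For the other, induction on a shows that one of a and b is the other
    plus some c, with c bounded to keep the formula in [SigmaB0]; in the unwanted case antisymmetry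
    gives a = b. *)
Lemma mleP a b : a <= b <-> exists c, b = a + c.
Proof.
split=> [leab|[c ->]]; last exact: mle_addr.
have: (exists c, c <= b /\ b = a + c) \/ (exists c, c <= a /\ a = b + c).
  refine (@induct (FExLe (NVar 1) (NVar 2 == NVar 1 + NVar 0)
    \/ FExLe (NVar 0) (NVar 1 == NVar 2 + NVar 0))%F
    (scons b e0) r0 _ _ _ a) => /=; first by sigma.
    by left; exists b; split; [apply: mle_refl|rewrite madd0].
  move=> i [] [c [lec E]].
    case: (classic (c = 0)) => [c0|/mpred[d _ Ed]].
      right; exists 1; rewrite E c0 mB3; split=> //.
      by rewrite maddC; apply: mle_addr.
    left; exists d; rewrite E -Ed; split; last by ring.
    have -> : i + (d + 1) = d + (i + 1) by ring.
    exact: mle_addr.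
  right; exists (c + 1); rewrite E; split; last by ring.
  have -> : b + c + 1 = c + 1 + b by ring.
  exact: mle_addr.
case=> -[c [_ E]]; first by exists c.
exists 0; rewrite mB3; apply: mle_anti => //; rewrite E; exact: mle_addr.
Qed.

Lemma mltP a b : a < b <-> exists c, b = a + c + 1.
Proof.
split=> [[/mleP[c E] nab]|[c ->]].
  case: (classic (c = 0)) => [c0|/mpred[d _ Ed]].
    by case: nab; rewrite E c0 mB3.
  by exists d; rewrite E -Ed maddA.
by apply/mltS/mle_addr.
Qed.

Lemma mle_trans b a c : a <= b -> b <= c -> a <= c.
Proof. by move=> /mleP[d ->] /mleP[d' ->]; rewrite -maddA; apply: mle_addr. Qed.

Lemma mltW a b : a < b -> a <= b.
Proof. by case. Qed.

Lemma mltnn a : ~ a < a.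
Proof. by case=> _; apply. Qed.

Lemma mle_lt_trans b a c : a <= b -> b < c -> a < c.
Proof.
move=> leab [lebc nbc]; split; first exact: mle_trans lebc.
by move=> E; apply: nbc; apply: mle_anti; rewrite // -E.
Qed.

Lemma mlt_le_trans b a c : a < b -> b <= c -> a < c.
Proof.
move=> [leab nab] lebc; split; first exact: mle_trans lebc.
by move=> E; apply: nab; apply: mle_anti; rewrite // E.
Qed.

Lemma mlt_trans b a c : a < b -> b < c -> a < c.
Proof. by move=> /mltW; apply: mle_lt_trans. Qed.

Lemma mlt_geF a b : a < b -> b <= a -> False.
Proof. by move=> ltab /(mlt_le_trans ltab); apply: mltnn. Qed.

Lemma mlt_leS a b : a < b -> a + 1 <= b.
Proof. by case/mltP=> c ->; apply/mleP; exists c; ring. Qed.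

Lemma mltSS a b : a < b -> a + 1 < b + 1.
Proof. by move/mlt_leS/mltS. Qed.

Lemma mlt_wS a b : a < b -> a < b + 1.
Proof. by move=> ltab; apply/mltS/mltW. Qed.

Lemma mle_eqVlt a b : a <= b -> a = b \/ a < b.
Proof. by move=> leab; case: (classic (a = b)); [left|right]. Qed.

Lemma mle_addl a b : b <= a + b.
Proof. by rewrite maddC; apply: mle_addr. Qed.

Lemma mle_add2 a b c d : a <= b -> c <= d -> a + c <= b + d.
Proof.
by move=> /mleP[u ->] /mleP[v ->]; apply/mleP; exists (u + v); ring.
Qed.

Lemma mle_mul2 a b c d : a <= b -> c <= d -> a * c <= b * d.
Proof.
move=> /mleP[u ->] /mleP[v ->]; apply/mleP.
by exists (a * v + u * c + u * v); ring.
Qed.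

Lemma mlt_total a b : a < b \/ a = b \/ b < a.
Proof.
case: (mlt_or_ge a b) => [|/mle_eqVlt[]]; first by left.
  by right; left.
by right; right.
Qed.

Lemma ind_upto n P : representable (n + 1) P ->
  P 0 -> (forall i, i < n -> P i -> P (i + 1)) -> forall i, i <= n -> P i.
Proof.
move=> [Y memY] P0 PS i lein; apply: ind_top => //.
  exists Y => j /mltS leji; apply/memY/mltS; exact: mle_trans lein.
by move=> j ltji; apply: PS; apply: mlt_le_trans lein.
Qed.

Lemma representable_sat A e r b : SigmaB1 A ->
  representable b (fun i => sat (scons i e) r A).
Proof. by move=> SA; have [Y [_ memY]] := comprehension e r b SA; exists Y. Qed.

Lemma representable_not b P : representable b P -> representable b (fun i => ~ P i).
Proof.
case=> Y memY; have [|X [_ memX]] := @comprehension (~ FMem (NVar 0) 0%N)%F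
  e0 (scons Y r0) b; first by sigma.
by exists X => i ltib; have := memX i ltib; have := memY i ltib; rewrite /=; tauto.
Qed.

(** * Pairing and coded sequences *)

Definition mpair a b : num M := (a + b) * (a + b + 1) + 2 * b.

(** The sum s = a + b is determined by the pair, since 2b <= 2s lies below the gap 2(s + 1) between
    s(s + 1) and (s + 1)(s + 2). *)
Lemma mpair_inj a b a' b' : mpair a b = mpair a' b' -> a = a' /\ b = b'.
Proof.
have half s s' c c' : c <= s -> s < s' ->
    s * (s + 1) + 2 * c = s' * (s' + 1) + 2 * c' -> False.
  (* In the absence of subtraction, the number given to [mB1] is the difference of the two sides
     less one, computed from s = c + u and s' = s + v + 1. *)
  move=> /mleP[u ->] /mltP[v ->] E; apply: (@mB1 (2 * u + 2 * (c + u) * v +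
    v * v + (2 + 1) * v + 1 + 2 * c')).
  apply: (maddI (c := (c + u) * (c + u + 1) + 2 * c)).
  by rewrite madd0 [RHS]E; ring.
have halfI c c' : 2 * c = 2 * c' -> c = c'.
  move=> E; have [|[//|]] := mlt_total c c'; move/mltP=> [u Eu]; exfalso.
    apply: (@mB1 (2 * u + 1)); apply: (maddI (c := 2 * c)).
    by rewrite madd0 [RHS]E Eu; ring.
  apply: (@mB1 (2 * u + 1)); apply: (maddI (c := 2 * c')).
  by rewrite madd0 -[RHS]E Eu; ring.
rewrite /mpair => E; have [H|[H|H]] := mlt_total (a + b) (a' + b').
- by case: (half _ _ _ _ (mle_addl a b) H E).
- have /halfI Eb: 2 * b = 2 * b'.
    by move: E; rewrite H maddC [RHS]maddC => /maddI.
  by split=> //; apply: (maddI (c := b)); rewrite H Eb.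
- by case: (half _ _ _ _ (mle_addl a' b') H (esym E)).
Qed.

Lemma mpair_le a b a' b' : a <= a' -> b <= b' -> mpair a b <= mpair a' b'.
Proof.
move=> lea leb; have les := mle_add2 lea leb.
apply: mle_add2; apply: mle_mul2 => //; try exact: mle_refl.
by apply: mle_add2 => //; apply: mle_refl.
Qed.

Lemma mpair_ger a b : b <= mpair a b.
Proof. by apply/mleP; exists ((a + b) * (a + b + 1) + b); rewrite /mpair; ring. Qed.

(** Ordinary comprehension on codes z, for the formula saying that z is a pair of bounded j and i
    satisfying [A]. That formula puts [A] under bounded number quantifiers, hence [SigmaB0]. The
    length bound has the shape used in [isBinLen]. *)
Lemma comp_pairs A e r a b : SigmaB0 A ->
  exists F, mlen F <= mpair a b + 1 /\ forall j i, j <= a -> i <= b ->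
    (mmem (mpair j i) F <-> sat (scons i (scons j e)) r A).
Proof.
move=> SA.
pose A' := fsubst (scons (NVar 0) (scons (NVar 1) (fun p => NVar p.+4.+1))) id A.
pose B := FExLe (NVar 1) (FExLe (NVar 3)
  (NVar 2 == npair (NVar 1) (NVar 0) /\ A')%F).
have SB: SigmaB1 B by sigma; apply: SigmaB0_fsubst.
have [F [lenF memF]] := comprehension (scons a (scons b e)) r (mpair a b + 1) SB.
have satA' i j z : sat (scons i (scons j (scons z (scons a (scons b e))))) r A' =
    sat (scons i (scons j e)) r A.
  rewrite sat_fsubst; congr (sat _ _ _).
  by apply: functional_extensionality => -[|[|p]].
exists F; split=> // j i leja leib.
have ltp: mpair j i < mpair a b + 1 by apply/mltS/mpair_le.
rewrite (memF _ ltp) /=; split.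
  case=> j' [_] [i'] [_] [/mpair_inj[Ej Ei]].
  by rewrite satA' -Ej -Ei.
by move=> H; exists j; split=> //; exists i; split=> //; rewrite satA'.
Qed.

Lemma str_eq X Y : (forall i, mmem i X <-> mmem i Y) -> X = Y.
Proof.
have len_le U V : (forall i, mmem i U <-> mmem i V) -> mlen U <= mlen V.
  move=> E; case: (mlt_or_ge (mlen V) (mlen U)) => // ltVU.
  have [|k _ Ek] := @mpred (mlen U).
    by move=> E0; rewrite E0 in ltVU; case: (mlt0 ltVU).
  by rewrite -Ek; apply/mlt_leS/mem_lt/E/mem_last.
move=> E; apply: str_ext => [|i _]; last exact: E.
by apply: mle_anti; apply: len_le => i; rewrite E.
Qed.

(* Each predicate below is stated so as to be convertible to the satisfaction
   of the formula it interprets, redundant bounds included. *)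

Definition mseq W a b : Prop :=
  (b < mlen W /\ mmem (mpair a b) W /\
   forall k, k <= b -> k < b -> ~ mmem (mpair a k) W) \/
  (b = mlen W /\
   forall k, k <= mlen W -> k < mlen W -> ~ mmem (mpair a k) W).

Lemma mseq_fun W a b b' : mseq W a b -> mseq W a b' -> b = b'.
Proof.
have no_lt c d : mseq W a c -> mseq W a d -> c < d -> False.
  case=> [[ltc [Wc _]]|[-> _]].
    case=> [[_ [_ min]] ltcd|[-> none] ltcd]; first exact: min (mltW ltcd) ltcd Wc.
    exact: none (mltW ltcd) ltcd Wc.
  by case=> [[ltd _] /mltW|[-> _]]; [apply: mlt_geF|apply: mltnn].
by move=> H H'; case: (mlt_total b b') => [/no_lt|[//|/no_lt]] [].
Qed.

Lemma mseq_le W a b : mseq W a b -> b <= mlen W.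
Proof. by case=> [[[]]|[-> _]] //; apply: mle_refl. Qed.

(** One induction for three comparisons; [c] delays the index and [d] offsets the value. It is used
    with (c, d) = (0, 0) for uniqueness of powers, (0, 1) for val(U) + 1 and (1, 0) for
    val(S(U)). *)
Lemma seq_compare W W' c d n :
  (exists q, mseq W' c q /\ mseq W 0 (q + d)) ->
  (forall j q, j < n -> mseq W' (j + c) q -> mseq W j (q + d) ->
    exists q', mseq W' (j + c + 1) q' /\ mseq W (j + 1) (q' + d)) ->
  forall j, j <= n -> exists q, mseq W' (j + c) q /\ mseq W j (q + d).
Proof.
move=> H0 HS; apply: ind_upto.
(* An entry of [W'] never exceeds |W'|, even by default, so its quantifier can be bounded. *)
- have := @representable_sat (FExLe (NLen 1)
    (isSeq 1 (NVar 1 + NVar 2) (NVar 0) /\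
     isSeq 0 (NVar 1) (NVar 0 + NVar 3)))%F
    (scons c (scons d e0)) (scons W (scons W' r0)) (n + 1).
  case; first by sigma.
  move=> Y memY; exists Y => i lti; apply: (iff_trans (memY i lti)).
  split=> [[q [_ [H1 H2]]]|[q [H1 H2]]]; exists q; split=> //.
  exact: mseq_le H1.
- by rewrite madd0.
- move=> j ltjn [q [H1 H2]]; rewrite maddS; exact: HS ltjn H1 H2.
Qed.

Definition mpowers W n : Prop :=
  mseq W 0 1 /\ forall j, j < n -> exists p, mseq W j p /\ mseq W (j + 1) (2 * p).

Lemma powers_unique W W' n j p : mpowers W n -> mpowers W' n -> j <= n ->
  mseq W j p -> mseq W' j p.
Proof.
move=> [W0 WS] [W'0 W'S] lejn Wj.
have [] := @seq_compare W W' 0 0 n _ _ j lejn; first by exists 1; rewrite mB3.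
  move=> i q ltin; rewrite !mB3 => H1 H2.
  have [p1 [H3 H4]] := WS i ltin; have [p2 [H5 H6]] := W'S i ltin.
  exists (2 * q); rewrite mB3 {1}(mseq_fun H1 H5) (mseq_fun H2 H3); split=> //.
move=> q; rewrite !mB3 => -[H1 H2].
by rewrite (mseq_fun Wj H2).
Qed.

Definition mbinlen a u : Prop :=
  exists W, mlen W <= mpair u (2 * a + 1) + 1 /\
    (mseq W 0 1 /\
     (forall j, j <= u -> j < u ->
        exists p, mseq W j p /\ mseq W (j + 1) (2 * p) /\ p <= a) /\
     exists p, mseq W u p /\ a < p).

(** The non-default case of [mseq]. The default |W| changes when the string is replaced by a longer
    one, so only genuine entries can be carried over to an extended sequence. *)
Definition mpoint W a b : Prop :=
  mmem (mpair a b) W /\ forall k, k <= b -> k < b -> ~ mmem (mpair a k) W.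

Definition isPoint (W : nat) (t u : nterm) : form :=
  (FMem (npair t u) W /\ FAllLt u (~ FMem (npair (shiftN t) (NVar 0)) W))%F.

Lemma mpoint_seq W a b : mpoint W a b -> mseq W a b.
Proof.
move=> [Wb minb]; left; split=> //.
exact: mle_lt_trans (mpair_ger a b) (mem_lt Wb).
Qed.

Lemma mpoint_fun W a b b' : mpoint W a b -> mpoint W a b' -> b = b'.
Proof. by move=> /mpoint_seq H /mpoint_seq; apply: mseq_fun. Qed.

(** If no length existed, a list of powers of two could be prolonged as long as wanted without
    exceeding x before its last entry; x + 1 steps then give 2^x <= x. *)
Lemma binlen_exists x : exists l, mbinlen x l.
Proof.
apply: NNPP => nlen.
(* The conditions of [mbinlen] without the final overshoot, and with all quantifiers bounded. The
   last power fits under 2x + 1: it is the double of one at most x, or it is 1, which must fit even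
   for x = 0. *)
pose P k := exists W, mlen W <= mpair k (2 * x + 1) + 1 /\
  (mpoint W 0 1 /\
   (forall j, j <= k -> j < k ->
      exists p, p <= x /\ (mpoint W j p /\ mpoint W (j + 1) (2 * p))) /\
   exists p, p <= 2 * x + 1 /\ mpoint W k p).
have le2x p : p <= x -> 2 * p <= 2 * x + 1.
  move=> lep; apply: mle_trans (mle_addr _ _).
  by apply: mle_mul2 => //; apply: mle_refl.
have [W [_ [W0 [WS _]]]]: P (x + 1).
  apply: ind_top.
  - apply: (@representable_sat (FExSLe (npair (NVar 0) (2 * NVar 1 + 1) + 1)
      (isPoint 0 0 1 /\
       FAllLt (NVar 0) (FExLe (NVar 2)
         (isPoint 0 (NVar 1) (NVar 0) /\ isPoint 0 (NVar 1 + 1) (2 * NVar 0))) /\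
       FExLe (2 * NVar 1 + 1) (isPoint 0 (NVar 1) (NVar 0))))%F (scons x e0) r0).
    by sigma.
  - have [|W [lenW memW]] := @comp_pairs (NVar 0 == 1)%F e0 r0 0 (2 * x + 1).
      by sigma.
    have W0: mpoint W 0 1.
      split; first by apply/memW => //; [apply: mle_refl|apply: mle_addl].
      move=> k lek [_ nk] Wk; apply/nk/(proj1 (memW _ _ (mle_refl _) _) Wk).
      exact: mle_trans lek (mle_addl _ _).
    exists W; split=> //; split=> //; split; first by move=> j _ /mlt0.
    by exists 1; split=> //; apply: mle_addl.
  - move=> k ltkx [W [lenW [W0 [WS [p [lep Wp]]]]]].
    have lepx: p <= x.
      (* A last entry above x would make [W] a witness of |x| = k. *)
      case: (mlt_or_ge x p) => // ltxp; case: nlen; exists k, W; split=> //.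
      split; first exact: mpoint_seq.
      split; last by exists p; split=> //; apply: mpoint_seq.
      move=> j lej ltj; have [q [leq [H1 H2]]] := WS j lej ltj.
      by exists q; split; [apply: mpoint_seq|split=> //; apply: mpoint_seq].
    (* [V] copies the entries of [W] up to index k and receives 2p at index k + 1. *)
    have [|V [lenV memV]] := @comp_pairs
      ((NVar 1 <= NVar 2 /\ FMem (npair (NVar 1) (NVar 0)) 0) \/
       (NVar 1 == NVar 2 + 1 /\ NVar 0 == NVar 3))%F
      (scons k (scons (2 * p) e0)) (scons W r0) (k + 1) (2 * x + 1).
      by sigma.
    have leVW j i : j <= k -> i <= 2 * x + 1 ->
        (mmem (mpair j i) V <-> mmem (mpair j i) W).
      move=> lej lei; rewrite memV //=; last exact: mle_trans lej (mle_addr _ _).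
      split=> [[[]|[E _]]|] //; last by left.
      by case: (mltnn (a := k)); apply: mleS_lt; rewrite -E.
    have VW j q : j <= k -> q <= 2 * x + 1 -> mpoint W j q -> mpoint V j q.
      move=> lej leq [Wq minq]; split; first exact/leVW.
      move=> i lei lti Vi; apply: (minq i) => //; apply/leVW => //.
      exact: mle_trans leq.
    have V2p: mpoint V (k + 1) (2 * p).
      split; first by apply/memV; [apply: mle_refl|apply: le2x|right].
      move=> i lei [_ ni] Vi.
      have lei2 := mle_trans lei (le2x _ lepx).
      case: (proj1 (memV _ _ (mle_refl _) lei2) Vi) => -[] //.
      by move=> /(mlt_geF (mltSn k)).
    exists V; split=> //; split.
      by apply: VW => //; [apply: mle0|apply: mle_addl].
    split; last by exists (2 * p); split=> //; apply: le2x.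
    move=> j _ /mltS/mle_eqVlt[->|ltjk].
      by exists p; split=> //; split=> //; apply: VW => //; apply: mle_refl.
    have [q [leq [H1 H2]]] := WS j (mltW ltjk) ltjk.
    exists q; split=> //; split; first apply: VW => //.
    - exact: mltW.
    - by apply: mle_trans leq _; apply/mleP; exists (x + 1); ring.
    - by apply: VW => //; [apply: mlt_leS|apply: le2x].
(* The induction j < 2^j, along the entries of [W]. *)
have [p [lep [_ ltxp]]]: exists p, p <= x /\ (mpoint W x p /\ x < p).
  apply: (ind_top (P := fun j => exists p, p <= x /\ (mpoint W j p /\ j < p))).
  - apply: (@representable_sat (FExLe (NVar 1)
      (isPoint 0 (NVar 1) (NVar 0) /\ NVar 1 < NVar 0))%F (scons x e0) (scons W r0)).
    by sigma.
  - have [|p [lep [H _]]] := WS 0 (mle0 _).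
      by apply/mltS/mle0.
    exists p; split=> //; split=> //; rewrite (mpoint_fun H W0) -(madd0 1).
    exact: mltSn.
  - move=> j ltjx [p [lep [Wp ltjp]]].
    have ltj1: j < x + 1 by apply: mlt_wS.
    have [p1 [_ [H1 H2]]] := WS j (mltW ltj1) ltj1.
    have ltj2: j + 1 < x + 1 by apply: mltSS.
    have [p2 [lep2 [H3 _]]] := WS (j + 1) (mltW ltj2) ltj2.
    exists p2; split=> //; split=> //.
    rewrite (mpoint_fun H3 H2) (mpoint_fun H1 Wp).
    by case/mltP: ltjp => c ->; apply/mltP; exists (j + 2 * c); ring.
exact: mlt_geF ltxp lep.
Qed.

Lemma binlen_powers a u W :
  (forall j, j <= u -> j < u ->
     exists p, mseq W j p /\ mseq W (j + 1) (2 * p) /\ p <= a) ->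
  mseq W 0 1 -> forall n, n <= u -> mpowers W n.
Proof.
move=> WS W0 n lenu; split=> // j ltjn; have ltju := mlt_le_trans ltjn lenu.
by have [p [H1 [H2 _]]] := WS j (mltW ltju) ltju; exists p.
Qed.

Lemma binlen_neq0 x l : x <> 0 -> mbinlen x l -> l <> 0.
Proof.
move=> nzx [W [_ [W0 [_ [p [Wl ltp]]]]]] l0; apply: nzx.
rewrite l0 in Wl; rewrite (mseq_fun Wl W0) -(madd0 1) in ltp.
by apply: mle_anti (mle0 x); apply/mltS.
Qed.

(** Both lists of powers agree where both are defined. If l' <= l, then 2^l' <= 2x, so it does not
    overshoot 2x; if l' > l + 1, then 2^(l + 1) <= 2x although x < 2^l. At x = 0 both lengths are
    0. *)
Lemma binlen_double x l l' : x <> 0 -> mbinlen x l -> mbinlen (2 * x) l' ->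
  l' = l + 1.
Proof.
move=> nzx lenx; have nzl := binlen_neq0 nzx lenx.
case: lenx => W [_ [W0 [WS [p [Wp ltxp]]]]] [V [_ [V0 [VS [q [Vq ltxq]]]]]].
have WP := binlen_powers WS W0; have VP := binlen_powers VS V0.
have [ltl|[//|ltl]] := mlt_total l' (l + 1); exfalso.
  have lel: l' <= l by apply/mltS.
  have Wq: mseq W l' q.
    apply: powers_unique (VP _ (mle_refl _)) (WP _ lel) _ Vq; exact: mle_refl.
  case/mle_eqVlt: lel => [El|ltl'l].
    have [k _ Ek] := mpred nzl.
    have ltkl: k < l by rewrite -Ek; apply: mltSn.
    have [c [_ [H2 lec]]] := WS k (mltW ltkl) ltkl.
    rewrite El -Ek in Wq; rewrite (mseq_fun Wq H2) in ltxq.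
    by apply: (mlt_geF ltxq); apply: mle_mul2 => //; apply: mle_refl.
  have [c [H1 [_ lec]]] := WS l' (mltW ltl'l) ltl'l.
  apply: (mlt_geF ltxq); rewrite (mseq_fun Wq H1); apply: mle_trans lec _.
  by apply/mleP; exists x; ring.
have ltll': l < l' by apply: mlt_trans ltl; apply: mltSn.
have Vp: mseq V l p.
  apply: powers_unique (WP _ (mle_refl _)) (VP _ (mltW ltll')) _ Wp; exact: mle_refl.
have [c [H1 [H2 _]]] := VS l (mltW ltll') ltll'.
have [d [H3 [_ led]]] := VS (l + 1) (mltW ltl) ltl.
move: led; rewrite (mseq_fun H3 H2) (mseq_fun H1 Vp); apply: mlt_geF.
by case/mltP: ltxp => b ->; apply/mltP; exists (2 * b + 1); ring.
Qed.

(** * Values of U and S(U) *)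

Definition mone_str l X : Prop :=
  mlen X <= l /\ forall i, i <= l -> i < l -> mmem i X.

Lemma one_str_exists l : exists X, mone_str l X.
Proof.
have [|X [lenX memX]] := @comprehension (FBot -> FBot)%F e0 r0 l; first by sigma.
by exists X; split=> // i _ lti; apply/memX.
Qed.

Lemma one_str_len l X : mone_str l X -> mlen X = l.
Proof.
move=> [leX memX]; apply: mle_anti => //.
case: (classic (l = 0)) => [->|/mpred[k _ Ek]]; first exact: mle0.
rewrite -{1}Ek; apply/mlt_leS/mem_lt/memX; rewrite -Ek; last exact: mltSn.
exact: mle_addr.
Qed.

Definition msucc_str X Y : Prop :=
  mlen Y <= mlen X + 1 /\
  forall i, i <= mlen X -> (mmem i Y <->
    (mmem i X /\ exists k, k <= i /\ (k < i /\ ~ mmem k X)) \/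
    (~ mmem i X /\ forall k, k <= i -> k < i -> mmem k X)).

(** The carry runs through all l ones, leaving a single one at position l. *)
Lemma succ_one_str l X Y : mone_str l X -> msucc_str X Y ->
  mlen Y = l + 1 /\ forall i, mmem i Y -> i = l.
Proof.
move=> oneX; have lenX := one_str_len oneX.
case: oneX => _ memX [lenY memY]; rewrite lenX in lenY memY.
have Yl: mmem l Y.
  apply/memY; first exact: mle_refl.
  right; split; first by move/mem_lt; rewrite lenX; apply: mltnn.
  by move=> k lek ltk; apply: memX.
split; first by apply: mle_anti => //; apply/mlt_leS/mem_lt.
move=> i Yi; have leil: i <= l by apply/mltS; apply: mlt_le_trans (mem_lt Yi) lenY.
case: (mle_eqVlt leil) => // lti.
have [[_ [k [_ [ltki []]]]]|[[]]] := proj1 (memY i leil) Yi; last exact: memX.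
by have ltkl := mlt_trans ltki lti; apply: memX => //; apply: mltW.
Qed.

Definition mbit X j : Prop :=
  exists k, k <= mlen X /\ (k < mlen X /\ (k + 1 + j = mlen X /\ mmem k X)).

Definition mval a b X z : Prop :=
  exists W, mlen W <= mpair a (2 * b + 1) + 1 /\
    ((mlen X = 0 -> z = 0) /\
     (~ mlen X = 0 -> mseq W 0 0 /\ mseq W a z /\
       forall j, j <= a -> j < a -> exists q, mseq W j q /\
         ((mlen X <= j -> mseq W (j + 1) q) /\
          (j < mlen X /\ ~ mbit X j -> mseq W (j + 1) (2 * q)) /\
          (j < mlen X /\ mbit X j -> mseq W (j + 1) (2 * q + 1))))).

(** Reading a one sends q to 2q + 1, that is, q + 1 to 2(q + 1), so value plus one follows the
    powers of two. *)
Lemma val_one W l p b X z : l <> 0 -> mpowers W l -> mseq W l p ->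
  mone_str l X -> mval (l + 1) b X z -> p = z + 1.
Proof.
move=> nzl [W0 WS] Wp oneX; have lenX := one_str_len oneX.
case: oneX => _ memX [V [_ [_]]]; rewrite lenX => /(_ nzl) [V0 [Vz VS]].
have [] := @seq_compare W V 0 1 l _ _ l (mle_refl l).
- by exists 0; rewrite madd0.
- move=> j q ltjl; rewrite !mB3 => Vj Wj.
  have ltjl1 := mlt_wS ltjl.
  have [q' [Vj' [_ [_ HV]]]] := VS j (mltW ltjl1) ltjl1.
  have [p' [Wj' HW]] := WS j ltjl.
  exists (2 * q + 1); split; last first.
    rewrite (_ : 2 * q + 1 + 1 = 2 * p') //.
    by rewrite (mseq_fun Wj' Wj); ring.
  rewrite (mseq_fun Vj Vj'); apply: HV; split=> //.
  case/mltP: ltjl => k Ek; have ltkl: k < l by apply/mltP; exists j; rewrite Ek; ring.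
  exists k; rewrite lenX; split; first exact: mltW.
  split=> //; split; first by rewrite Ek; ring.
  by apply: memX => //; apply: mltW.
move=> q; rewrite !mB3 => -[Vl Wl].
(* Of the l + 1 steps, the last is past the end of [X] and repeats the value. *)
have [q' [Vl' [HV _]]] := VS l (mle_addr _ _) (mltSn l).
rewrite (mseq_fun Wp Wl) (mseq_fun Vl Vl').
by rewrite (mseq_fun Vz (HV (mle_refl l))).
Qed.

(** The first step reads the leading one and gives 1; every later step reads a zero and doubles. The
    value is thus the sequence of powers, one index late. *)
Lemma val_succ_one W l p b X z : mpowers W l -> mseq W l p ->
  mlen X = l + 1 -> (forall i, mmem i X -> i = l) -> mval (l + 1) b X z -> p = z.
Proof.
move=> [W0 WS] Wp lenX memX [V [_ [_]]]; rewrite lenX.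
case=> [/mB1//|V0 [Vz VS]].
have [] := @seq_compare W V 1 0 l _ _ l (mle_refl l).
- exists 1; rewrite mB3; split=> //.
  have lt0: 0 < l + 1 by apply/mltS/mle0.
  have [q [Vq [_ [_]]]] := VS 0 (mle0 _) lt0.
  rewrite (mseq_fun Vq V0) madd0 (_ : 2 * 0 + 1 = 1); last by ring.
  apply; split=> //; exists l; rewrite lenX; split; first exact: mle_addr.
  by split; [apply: mltSn|split; [ring|apply: mem_last]].
- move=> j q ltjl; rewrite !mB3 => Vj Wj.
  have ltj1 := mltSS ltjl.
  have [q' [Vj' [_ [HV _]]]] := VS (j + 1) (mltW ltj1) ltj1.
  have [p' [Wj' HW]] := WS j ltjl.
  exists (2 * q); rewrite mB3; split; last by rewrite (mseq_fun Wj Wj').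
  rewrite (mseq_fun Vj Vj'); apply: HV; split=> //.
  case=> k [_ [_ [Ek /memX El]]]; apply: (@mB1 j).
  apply: (maddI (c := l + 1)); rewrite madd0 -{2}lenX -Ek El; ring.
move=> q; rewrite !mB3 => -[Vl Wl].
by rewrite (mseq_fun Wp Wl) (mseq_fun Vl Vz).
Qed.

(** A total injective relation from n + 2 pigeons to n + 1 holes yields one from n + 1 to n: pigeons
    in hole n move to the holes of pigeon n + 1. Injectivity keeps that pigeon itself out of hole n
    whenever another one is there. *)
Lemma php x F : mlen F <= mpair x x + 1 ->
  (forall j, j <= x -> exists i, i <= x /\ (i < x /\ mmem (mpair j i) F)) ->
  (forall j, j <= x -> forall j', j' <= x -> forall i, i <= x -> i < x ->
     mmem (mpair j i) F -> mmem (mpair j' i) F -> j = j') -> False.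
Proof.
pose P n := exists F, mlen F <= mpair x x + 1 /\
  ((forall j, j <= n -> exists i, i <= n /\ (i < n /\ mmem (mpair j i) F)) /\
   (forall j, j <= n -> forall j', j' <= n -> forall i, i <= n -> i < n ->
      mmem (mpair j i) F -> mmem (mpair j' i) F -> j = j')).
suff nPx: ~ P x by move=> lenF tot inj; apply: nPx; exists F.
(* The property is a negated [SigmaB1] one; its string is a complement. The length bound in [P]
   depends on x alone, so that it stays fixed along the induction. *)
apply: (ind_top (P := fun n => ~ P n)).
- apply: representable_not.
  apply: (@representable_sat (FExSLe (npair (NVar 1) (NVar 1) + 1)
    (FAllLe (NVar 0) (FExLt (NVar 1) (FMem (npair (NVar 1) (NVar 0)) 0)) /\
     FAllLe (NVar 0) (FAllLe (NVar 1) (FAllLt (NVar 2)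
       (FMem (npair (NVar 2) (NVar 0)) 0 -> FMem (npair (NVar 1) (NVar 0)) 0 ->
        NVar 2 == NVar 1)))))%F (scons x e0) r0).
  by sigma.
- by case=> G [_ [tot _]]; have [i [_ [/mlt0]]] := tot 0 (mle_refl 0).
move=> n ltnx nPn [G [lenG [tot inj]]]; apply: nPn.
have [|H [lenH memH]] := @comp_pairs (FMem (npair (NVar 1) (NVar 0)) 0 \/
  (FMem (npair (NVar 1) (NVar 2)) 0 /\ FMem (npair (NVar 2 + 1) (NVar 0)) 0))%F
  (scons n e0) (scons G r0) x x; first by sigma.
have {}memH j i : j <= n -> i <= n -> (mmem (mpair j i) H <->
    mmem (mpair j i) G \/ (mmem (mpair j n) G /\ mmem (mpair (n + 1) i) G)).
  by move=> lej lei; apply: memH; apply: mle_trans (mltW ltnx).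
have leS j : j <= n -> j <= n + 1 by move=> lej; apply: mle_trans (mle_addr _ _).
have {}inj j j' i : j <= n + 1 -> j' <= n + 1 -> i <= n ->
    mmem (mpair j i) G -> mmem (mpair j' i) G -> j = j'.
  by move=> lej lej' lei; apply: inj => //; [apply: leS|apply/mltS].
have neS j : j <= n -> j <> n + 1.
  by move=> lej E; apply: (mlt_geF (mltSn n)); rewrite -E.
exists H; split=> //; split.
  move=> j lej; have [i [_ [/mltS lein Gji]]] := tot j (leS _ lej).
  case: (mle_eqVlt lein) => [Ei|lti]; last first.
    by exists i; split=> //; split=> //; apply/memH => //; left.
  have [c [_ [/mltS lecn Gc]]] := tot (n + 1) (mle_refl _).
  have ltcn: c < n.
    case: (mle_eqVlt lecn) => // Ec; case: (neS j lej).
    rewrite Ei in Gji; rewrite Ec in Gc.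
    by apply: (inj _ _ n) => //; [apply: leS|apply: mle_refl|apply: mle_refl].
  exists c; split=> //; split=> //; apply/memH => //; right; split=> //.
  by rewrite -Ei.
move=> j lej j' lej' i lei lti Hj Hj'.
case: (proj1 (memH _ _ lej lei) Hj) (proj1 (memH _ _ lej' lei) Hj') =>
  [Gj|[Gj Gn]] [Gj'|[Gj' Gn']].
- by apply: (inj _ _ i) => //; apply: leS.
- case: (neS j lej); apply: (inj _ _ i) => //; first exact: leS.
  exact: mle_refl.
- case: (neS j' lej'); apply: (inj _ _ i) => //; first exact: leS.
  exact: mle_refl.
- by apply: (inj _ _ n) => //; [apply: leS|apply: leS|apply: mle_refl].
Qed.

(** * Iterating an inflationary operator *)

Definition mrow Z a i : Prop := i < mlen Z /\ mmem (mpair a i) Z.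

Definition misrow Z a Y : Prop :=
  mlen Y <= mlen Z /\
  forall i, i <= mlen Z -> i < mlen Z -> (mmem i Y <-> mrow Z a i).

Lemma misrow_mem Z a Y i : misrow Z a Y -> (mmem i Y <-> mrow Z a i).
Proof.
move=> [lenY memY]; split=> [Yi|rowi].
  have ltiZ := mlt_le_trans (mem_lt Yi) lenY.
  by apply/memY => //; apply: mltW.
by case: (rowi) => ltiZ _; apply/memY => //; apply: mltW.
Qed.

Section Iteration.
(** The inductions below speak of rows of given coded sequences and never mention [phi], which can
    therefore be a bare predicate. *)
Variables (phi : num M -> str M -> Prop) (x : num M).

Definition miter v Z : Prop :=
  (forall j, j <= v -> exists R, misrow Z j R /\ mlen R <= x) /\
  (exists R, misrow Z 0 R /\ mlen R = 0) /\
  (forall j, j <= v -> j < v -> forall i, i <= x -> i < x ->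
     (mrow Z (j + 1) i <-> exists R, misrow Z j R /\ phi i R)).

(** A row is unique as a string, so the existential in [miter] can be traded for any given [R]. *)
Lemma iter_step v Z j i R : miter v Z -> j < v -> i < x -> misrow Z j R ->
  (mrow Z (j + 1) i <-> phi i R).
Proof.
move=> [_ [_ step]] ltjv ltix rowR.
rewrite (step j (mltW ltjv) ltjv i (mltW ltix) ltix).
split=> [[R' [rowR' phiR']]|phiR]; last by exists R.
rewrite (_ : R = R') //; apply: str_eq => k.
by rewrite (misrow_mem _ rowR) (misrow_mem _ rowR').
Qed.

Lemma row_lt v Z j i : miter v Z -> j <= v -> mrow Z j i -> i < x.
Proof.
move=> [rows _] lejv rowi; have [R [rowR lenR]] := rows j lejv.
by apply: mlt_le_trans lenR; apply/mem_lt/(misrow_mem _ rowR).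
Qed.

(** Rows have length at most x, so agreement below x makes them the same string. Two codes at the
    same stage give [iter_agree]; one code at consecutive stages gives [iter_stable]. *)
Lemma iter_step_eq v v' Z Z' j j' : miter v Z -> miter v' Z' ->
  j < v -> j' < v' -> (forall i, i < x -> (mrow Z j i <-> mrow Z' j' i)) ->
  forall i, i < x -> (mrow Z (j + 1) i <-> mrow Z' (j' + 1) i).
Proof.
move=> it it' ltj ltj' E i ltix.
have [R [rowR lenR]] := proj1 it j (mltW ltj).
have [R' [rowR' lenR']] := proj1 it' j' (mltW ltj').
rewrite (iter_step it ltj ltix rowR) (iter_step it' ltj' ltix rowR').
rewrite (_ : R = R') //; apply: str_eq => k.
rewrite (misrow_mem _ rowR) (misrow_mem _ rowR').
split=> rowk; apply/E => //.
  exact: row_lt it (mltW ltj) rowk.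
exact: row_lt it' (mltW ltj') rowk.
Qed.

Lemma iter_agree v v' Z Z' : miter v Z -> miter v' Z' -> v' <= v ->
  forall i, i < x -> (mrow Z v' i <-> mrow Z' v' i).
Proof.
move=> it it' levv' i ltix.
suff: forall i, i <= x -> i < x -> (mrow Z v' i <-> mrow Z' v' i).
  by apply=> //; apply: mltW.
apply: (ind_top (P := fun j => forall i, i <= x -> i < x ->
  (mrow Z j i <-> mrow Z' j i))).
- apply: (@representable_sat (FAllLt (NVar 1)
    (rowMem 0 (NVar 1) (NVar 0) <-> rowMem 1 (NVar 1) (NVar 0)))%F
    (scons x e0) (scons Z (scons Z' r0))).
  by sigma.
- case: it it' => _ [[R [rowR lenR]] _] [_ [[R' [rowR' lenR']] _]] k _ _.
  rewrite -(misrow_mem _ rowR) -(misrow_mem _ rowR').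
  by split=> /mem_lt; rewrite ?lenR ?lenR' => /mlt0.
move=> j ltj E k _; apply: iter_step_eq it it' _ _ _ k => //.
  exact: mlt_le_trans levv'.
by move=> k' ltk'; apply: E => //; apply: mltW.
Qed.

Hypothesis infl : forall R, mlen R <= x -> forall i, i <= x -> i < x ->
  mmem i R -> phi i R.

Lemma iter_incr v Z j i : miter v Z -> j < v -> i < x ->
  mrow Z j i -> mrow Z (j + 1) i.
Proof.
move=> it ltjv ltix rowi; have [R [rowR lenR]] := proj1 it j (mltW ltjv).
apply/(iter_step it ltjv ltix rowR); apply: infl => //; first exact: mltW.
exact/(misrow_mem _ rowR).
Qed.

Lemma iter_mono v Z j j' i : miter v Z -> j <= j' -> j' <= v -> i < x ->
  mrow Z j i -> mrow Z j' i.
Proof.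
move=> it /mleP[k ->] lev ltix rowj; move: lev.
refine (@induct (NVar 1 + NVar 0 <= NVar 2 -> rowMem 0 (NVar 1 + NVar 0) (NVar 3))%F
  (scons j (scons v (scons i e0))) (scons Z r0) _ _ _ k); first by sigma.
  by move=> _; change (mrow Z (j + 0) i); rewrite mB3.
move=> n IH; change (j + (n + 1) <= v -> mrow Z (j + (n + 1)) i) => lev.
have ltv: j + n < v by apply: mleS_lt; rewrite -mB4.
by rewrite mB4; apply: (iter_incr it ltv ltix (IH (mltW ltv))).
Qed.

(** Inflation turns the hypothesis into equality of stages j and j + 1; equal stages have equal
    successors. *)
Lemma iter_stable v Z j k : miter (v + 1) Z ->
  (forall i, i < x -> mrow Z (j + 1) i -> mrow Z j i) -> j + k <= v ->
  forall i, i < x -> (mrow Z (j + k + 1) i <-> mrow Z (j + k) i).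
Proof.
move=> it fixj lejk i ltix.
suff: j + k <= v -> forall i, i <= x -> i < x ->
    (mrow Z (j + k + 1) i <-> mrow Z (j + k) i).
  by apply=> //; apply: mltW.
refine (@induct (NVar 1 + NVar 0 <= NVar 2 -> FAllLt (NVar 3)
   (rowMem 0 (NVar 2 + NVar 1 + 1) (NVar 0) <-> rowMem 0 (NVar 2 + NVar 1) (NVar 0)))%F
  (scons j (scons v (scons x e0))) (scons Z r0) _ _ _ k); first by sigma.
  change (j + 0 <= v -> forall i, i <= x -> i < x ->
    (mrow Z (j + 0 + 1) i <-> mrow Z (j + 0) i)).
  rewrite mB3 => lejv {ltix}i _ ltix; split; first exact: fixj.
  by apply: iter_incr it _ ltix; apply/mltS.
move=> n IH; change (j + (n + 1) <= v -> forall i, i <= x -> i < x ->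
    (mrow Z (j + (n + 1) + 1) i <-> mrow Z (j + (n + 1)) i)).
rewrite mB4 => lev {ltix}i _.
have ltv: j + n < v by apply: mleS_lt.
apply: (iter_step_eq it it); [exact/mltS|exact: mlt_wS|].
by move=> {}i ltix; apply: (IH (mltW ltv)) => //; apply: mltW.
Qed.

Lemma iter_fixpoint v Z : x <= v -> miter (v + 1) Z ->
  forall i, i < x -> (mrow Z (v + 1) i <-> mrow Z v i).
Proof.
move=> lexv it; apply: NNPP => nfix.
have new j : j <= v -> exists i, i < x /\ (mrow Z (j + 1) i /\ ~ mrow Z j i).
  move=> lejv; apply: NNPP => none; apply: nfix.
  have /mleP[k Ek] := lejv; rewrite Ek; apply: iter_stable it _ _; last first.
    by rewrite Ek; apply: mle_refl.
  move=> i ltix rowS; apply: NNPP => nrow; apply: none.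
  by exists i.
(* Pair (j, i) is in [F] when i enters between stages j and j + 1; x <= v allows j to range over 0,
   ..., x. *)
have [|F [lenF memF]] := @comp_pairs
  (rowMem 0 (NVar 1 + 1) (NVar 0) /\ ~ rowMem 0 (NVar 1) (NVar 0))%F
  e0 (scons Z r0) x x; first by sigma.
have {}memF j i : j <= x -> i <= x ->
  (mmem (mpair j i) F <-> mrow Z (j + 1) i /\ ~ mrow Z j i) := memF j i.
apply: (php lenF) => [j lej|j lej j' lej' i lei lti].
  have [i [ltix H]] := new j (mle_trans lej lexv).
  have leix := mltW ltix.
  by exists i; split=> //; split=> //; apply/memF.
move=> Fj Fj'.
have [Hj nHj] := proj1 (memF _ _ lej lei) Fj.
have [Hj' nHj'] := proj1 (memF _ _ lej' lei) Fj'.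
have top a : a <= x -> a <= v + 1.
  by move=> lea; apply: mle_trans (mle_trans lea lexv) (mle_addr _ _).
(* An element that enters at the earlier stage is still there at the later one, so it cannot enter
   again. *)
have [lt|[//|lt]] := mlt_total j j'; exfalso.
  by apply: nHj'; apply: iter_mono it _ _ lti Hj; [apply: mlt_leS|apply: top].
by apply: nHj; apply: iter_mono it _ _ lti Hj'; [apply: mlt_leS|apply: top].
Qed.

End Iteration.

(** * From satisfaction to the semantic statements *)

Lemma sat_appOp_weakOp (n m : nat) A t (X : nat) e r :
  sat e r (appOp (weakOp n m A) t X) =
  sat (M := M) (scons (eval e r t) (fun p => e (p + n)%N))
    (scons (r X) (fun p => r (p + m)%N)) A.
Proof.
rewrite /appOp /weakOp fsubst_comp sat_fsubst.
by congr (sat _ _ _); apply: functional_extensionality => -[].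
Qed.

Lemma sat_weakOp (n m : nat) A e r a X :
  sat (scons a e) (scons X r) (weakOp n m A) =
  sat (M := M) (scons a (fun p => e (p + n)%N))
    (scons X (fun p => r (p + m)%N)) A.
Proof.
rewrite /weakOp sat_fsubst.
by congr (sat _ _ _); apply: functional_extensionality => -[].
Qed.

(** Here m counts the strings bound around [psiP]. All parts translate by conversion except the
    occurrence of [phi], where the weakenings must be seen to restore its own environments. *)
Lemma sat_psiP phi x (m X Y : nat) r : (forall p, r (p + m)%N = r0 p) ->
  sat (scons x e0) r (psiP (weakOp 1 m phi) (NVar 0) (2 * NVar 0)%T X Y) ->
  exists l v Z, [/\ mbinlen (2 * x) l, mval l (2 * x) (r X) v,
    miter (fun i R => sat (scons i e0) (scons R r0) phi) x v Z & misrow Z v (r Y)].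
Proof.
move=> Er [l [lenl [v [valv [Z [_ [rows [row0 [rowv step]]]]]]]]].
exists l, v, Z; split=> //; split=> //; split=> // j lej ltj i lei lti.
have satphi R: sat (scons i (scons j (scons v (scons l (scons x e0)))))
    (scons R (scons Z r)) (appOp (weakOp 4 2 (weakOp 1 m phi)) (NVar 0) 0) =
    sat (scons i e0) (scons R r0) phi.
  rewrite sat_appOp_weakOp sat_weakOp; congr (sat (scons _ _) (scons _ _) _).
    by apply: functional_extensionality => p; rewrite !addn1 addn4.
  by apply: functional_extensionality => p; rewrite addn2 /= Er.
have [H1 H2] := step j lej ltj i lei lti.
split=> [/H1[R [rowR phiR]]|[R [rowR phiR]]].
  by exists R; split=> //; rewrite -satphi.
by apply: H2; exists R; split=> //; move: phiR; rewrite -satphi.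
Qed.

Lemma iteration_stable phi x :
  sat (scons x e0) r0 (inflationary (weakOp 1 0 phi) (NVar 0)) ->
  exists l U, [/\ mbinlen x l, mone_str l U & forall V Y Z, msucc_str U V ->
    sat (scons x e0) (scons V (scons Z (scons Y (scons U r0))))
      (psiP (weakOp 1 4 phi) (NVar 0) (2 * NVar 0)%T 0 2) ->
    sat (scons x e0) (scons Z (scons Y (scons U r0)))
      (psiP (weakOp 1 3 phi) (NVar 0) (2 * NVar 0)%T 2 0) ->
    forall i, i < x -> (mmem i Y <-> mmem i Z)].
Proof.
move=> infl_phi; pose Phi i R := sat (scons i e0) (scons R r0) phi.
have infl R : mlen R <= x -> forall i, i <= x -> i < x -> mmem i R -> Phi i R.
  move=> lenR i lei lti Ri.
  have: sat (scons i (scons x e0)) (scons R r0)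
      (appOp (weakOp 1 1 (weakOp 1 0 phi)) (NVar 0) 0).
    exact: infl_phi R lenR i lei lti Ri.
  rewrite sat_appOp_weakOp sat_weakOp /Phi.
  rewrite (_ : (fun p => _) = e0); last first.
    by apply: functional_extensionality => p; rewrite !addn1.
  rewrite (_ : (fun p => _) = r0) //.
  by apply: functional_extensionality => p; rewrite addn0 addn1.
have [l lenl] := binlen_exists x; have [U oneU] := one_str_exists l.
exists l, U; split=> // V Y Z succV psiY psiZ i lti.
(* An i below x is at hand, so the exceptional case x = 0 is excluded. *)
have nzx: x <> 0 by move=> x0; rewrite x0 in lti; case: (mlt0 lti).
have nzl := binlen_neq0 nzx lenl.
have [|l1 [v1 [Z1 [len1 val1 iter1 rowY]]]] := sat_psiP _ psiY.
  by move=> p; rewrite addn4.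
have [|l2 [v2 [Z2 [len2 val2 iter2 rowZ]]]] := sat_psiP _ psiZ.
  by move=> p; rewrite addn3.
rewrite (binlen_double nzx lenl len1) /= in val1.
rewrite (binlen_double nzx lenl len2) /= in val2.
have [lenV memV] := succ_one_str oneU succV.
have [W [_ [W0 [WS [p [Wp ltxp]]]]]] := lenl.
have powW := binlen_powers WS W0 (mle_refl l).
have Ev1 := val_succ_one powW Wp lenV memV val1.
have Ev2 := val_one nzl powW Wp oneU val2.
have Ev: v1 = v2 + 1 by rewrite -Ev1.
rewrite {}Ev in iter1 rowY.
(* From x < 2^|x| = v2 + 1, by the overshoot in the witness of |x|. *)
have lexv: x <= v2 by apply/mltS; rewrite -Ev2.
have Efix := iter_fixpoint infl lexv iter1 lti.
have Eagree := iter_agree iter1 iter2 (mle_addr _ _) lti.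
have EY := misrow_mem i rowY; have EZ := misrow_mem i rowZ.
by rewrite EY EZ Efix.
Qed.

End Arithmetic.

Theorem theorem3 (phi : form) (Hphi : SigmaB0 phi) :
  V1_proves
    (FAllN (let x := NVar 0 in
       inflationary (weakOp 1 0 phi) x ->
       FExS (let U : svar := 0%N in
         FExN (let l := NVar 0 in
           isBinLen (NVar 1) l /\
           FExS (isOne l 0%N /\ strLe U.+1 0%N)) /\
         FAllS (FAllS (let U := 2%N in let Y := 1%N in let Z := 0%N in
           FExS (isSucc U.+1 0%N /\
                psiP (weakOp 1 4 phi) x (2 * x) 0%N Y.+1) /\
           psiP (weakOp 1 3 phi) x (2 * x) U Z ->
           FAllLt x (FMem (NVar 0) Y <-> FMem (NVar 0) Z))))))%F.
Proof.
apply: completeness => M HM e r x; cbv zeta => infl.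
have [l [U [lenl oneU stable]]] := iteration_stable HM infl.
(* U is One(|x|) itself, so [strLe] holds by its equality case. *)
exists U; split; first by exists l; split=> //; exists U; split=> //; left.
by move=> Y Z [[V [succV psiY]] psiZ] i _ lti; apply: (stable V).
Qed.
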